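(* Let $\Sigma_3$ be the intersection of a hwise-fixed-5-space and an $\mathbb H_{\mathrm I}$-5-space (this is a 3-space), and let $\mathcal F$ be the set of all fixed-I-lines and fixed-II-lines contained in $\Sigma_3$. 1. If $q\equiv-1\pmod 3$, then $\mathcal F$ is an elliptic linear congruence of $\Sigma_3$. 2. If $q\equiv 0\pmod 3$, then $\mathcal F\cup\{\ell\}$ is a parabolic linear congruence with axis $\ell$, where $\ell$ is the unique ptwise-fixed line in $\Sigma_3$. 3. If $q\equiv 1\pmod 3$, then $\mathcal F$ is a hyperbolic linear congruence whose axes are the two ptwise-fixed lines in $\Sigma_3$.
   Context: Let $q>2$ be a prime power. Let $\phi$ be a collineation of $\mathrm{PG}(2,q^3)$ of order 3 fixing pointwise an $\mathbb F_q$-subplane $\mathcal P_{2,q}$. A point $\bar P$ of $\mathrm{PG}(2,q^3)$ has Type I if in $\mathcal P_{2,q}$, Type II if $\bar P,\bar P^\phi,\bar P^{\phi^2}$ are distinct and collinear; a Type-I-line is a line meeting $\mathcal P_{2,q}$ in $q+1$ points. Bose representation: identifying $\mathbb F_{q^3}^3$ with $\mathbb F_q^9$, each point $\bar P$ corresponds to a plane $[\![P]\!]$ of $\mathrm{PG}(8,q)$, and each line $\bar\ell$ to the 5-space spanned by the planes of its points; an $\mathbb H_{\mathrm I}$-5-space is one arising from a Type-I-line. A point is an X-point if it lies in $[\![P]\!]$ with $\bar P$ of Type X. $\phi$ induces a projectivity $\sigma$ of $\mathrm{PG}(8,q)$ of order 3 with $[\![P]\!]^\sigma=[\![P^\phi]\!]$.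 A ptwise-fixed line is a line fixed pointwise by $\sigma$. A I-point $A$ is a I$_{\vdots}$-point if $A,A^\sigma,A^{\sigma^2}$ are distinct and collinear; a II-point $B$ is a II$_{\vdots}$-point if $B,B^\sigma,B^{\sigma^2}$ are collinear. A fixed-I-line (fixed-II-line) is a $\sigma$-fixed line containing a I$_{\vdots}$-point (II$_{\vdots}$-point). A hwise-fixed-5-space is a 5-space $\Pi$ such that every 6-space containing $\Pi$ is fixed by $\sigma$. Linear congruences in a 3-space $\mathrm{PG}(3,q)$: an elliptic linear congruence is a regular line spread; a parabolic linear congruence is a set of $q^2+q+1$ lines consisting of an axis $\ell$ and a set $\mathcal L$ of $q^2+q$ lines such that each line of $\mathcal L$ meets $\ell$, any two distinct lines of $\mathcal L$ are disjoint or meet in a point of $\ell$, and $\mathcal L$ contains a regulus; a hyperbolic linear congruence is the set of $(q+1)^2$ lines meeting two given disjoint lines (the axes). *)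

(* Defs.v *)
From HB Require Import structures.
From mathcomp Require Import all_boot all_order all_algebra all_field.
Set Implicit Arguments.
Unset Strict Implicit.
Unset Printing Implicit Defensive.
Import GRing.Theory.
Local Open Scope ring_scope.

Section ProjectiveSpace.
Variables (K : fieldType) (V : vectType K).
Implicit Types U W P Q R l m : {vspace V}.

(* A subspace of projective dimension k has vector dimension k + 1. *)
Definition is_point U := \dim U = 1%N.
Definition is_line U := \dim U = 2%N.

Definition collinear P Q R : Prop :=
  exists l, [/\ is_line l, (P <= l)%VS, (Q <= l)%VS & (R <= l)%VS].

Definition skew l m : Prop := (l :&: m)%VS = 0%VS.
Definition meets l m : Prop := (l :&: m)%VS <> 0%VS.

Definition line_of (Sg : {vspace V}) l : Prop := is_line l /\ (l <= Sg)%VS.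

Definition collineation (phi : {vspace V} -> {vspace V}) : Prop :=
  bijective phi /\ forall U W, (phi U <= phi W)%VS = (U <= W)%VS.

Definition order3 (phi : {vspace V} -> {vspace V}) : Prop :=
  (forall U, phi (phi (phi U)) = U) /\ exists U, phi U <> U.

Definition projectivity (s : 'End(V)) : Prop := lker s = 0%VS.

Definition has_card (A : {vspace V} -> Prop) (n : nat) : Prop :=
  exists s : seq {vspace V},
    [/\ uniq s, size s = n & forall U, U \in s <-> A U].

End ProjectiveSpace.

Section LinearCongruences.
Variables (F : finFieldType) (V : vectType F).
Variable Sg : {vspace V}.
Implicit Types (C R : {vspace V} -> Prop) (l m : {vspace V}).

(* The regulus of transversals to three pairwise skew lines of the 3-space. *)
Definition regulus R : Prop :=
  exists a b c : {vspace V},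
    [/\ line_of Sg a, line_of Sg b & line_of Sg c] /\
    [/\ skew a b, skew a c & skew b c] /\
    forall m, R m <-> line_of Sg m /\ [/\ meets m a, meets m b & meets m c].

Definition line_spread C : Prop :=
  (forall m, C m -> line_of Sg m) /\
  forall P : {vspace V}, is_point P -> (P <= Sg)%VS ->
    exists! m, C m /\ (P <= m)%VS.

(* Three skew lines lie in exactly one regulus, so "a regulus" below is
   "the regulus they determine". *)
Definition elliptic_congruence C : Prop :=
  line_spread C /\
  forall l1 l2 l3, C l1 -> C l2 -> C l3 ->
    l1 <> l2 -> l1 <> l3 -> l2 <> l3 ->
    exists R, [/\ regulus R, R l1, R l2, R l3 & forall m, R m -> C m].

Definition parabolic_congruence C l : Prop :=
  line_of Sg l /\ has_card C (#|F| ^ 2 + #|F| + 1)%N /\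
  exists L : {vspace V} -> Prop,
    [/\ forall m, C m <-> m = l \/ L m,
        has_card L (#|F| ^ 2 + #|F|)%N,
        forall m, L m -> line_of Sg m /\ meets m l,
        forall m m', L m -> L m' -> m <> m' ->
          skew m m' \/ is_point (m :&: m')%VS /\ (m :&: m' <= l)%VS
      & exists R, regulus R /\ forall m, R m -> L m].

Definition hyperbolic_congruence C l1 l2 : Prop :=
  [/\ line_of Sg l1, line_of Sg l2, skew l1 l2 &
      forall m, C m <-> [/\ line_of Sg m, meets m l1 & meets m l2]].

End LinearCongruences.

(* The same functions 'I_3 -> L, once as the L-space underlying PG(2, q^3) and
   once as the 9-dimensional F-space underlying PG(8, q). *)
Definition VL (L : fieldType) : vectType L := {ffun 'I_3 -> L^o}.
Definition VF (F : fieldType) (L : fieldExtType F) : vectType F :=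
  {ffun 'I_3 -> L}.

Section Bose.
Variables (F : finFieldType) (L : fieldExtType F).
Implicit Types (P l : {vspace VL L}) (A B m Pi : {vspace VF L}).

(* The F-subspace with the same vectors as the L-subspace U: see mem_bose. *)
Definition bose (U : {vspace VL L}) : {vspace VF L} :=
  <<[seq ((b : L) *: (u : VL L)) : VF L | b <- vbasis {:L}, u <- vbasis U]>>%VS.

Let scaleVF (c : F) (v : VF L) : c *: v = c%:A *: (v : VL L) :> VL L.
Proof. by apply/ffunP=> i; rewrite !ffunE [RHS]mulr_algl. Qed.

Lemma mem_bose (U : {vspace VL L}) (v : VL L) :
  ((v : VF L) \in bose U) = (v \in U).
Proof.
apply/idP/idP => [|Uv].
  move=> /(@coord_span _ _ _ (in_tuple _)) ->.
  elim/big_ind: _ => [|x y Ux Uy|i _]; [exact: mem0v | exact: (rpredD Ux Uy) |].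
  rewrite scaleVF; apply: rpredZ.
  have /allpairsP[[b u] /= [_ Uu ->]] := mem_nth (0 : VF L) (ltn_ord i).
  by apply: rpredZ; apply: vbasis_mem.
rewrite (coord_vbasis Uv).
elim/big_ind: _ => [|x y Wx Wy|j _]; [exact: mem0v | exact: (@memvD _ _ (bose U) _ _ Wx Wy) |].
set u := (vbasis U)`_j.
have -> : coord (vbasis U) j v *: u =
    \sum_k (coord (vbasis {:L}) k (coord (vbasis U) j v))%:A
              *: ((vbasis {:L})`_k *: u).
  rewrite {1}(coord_vbasis (memvf (coord (vbasis U) j v))) scaler_suml.
  by apply: eq_bigr => k _; rewrite scalerA mulr_algl.
elim/big_ind: _ => [|x y Wx Wy|k _]; [exact: mem0v | exact: (@memvD _ _ (bose U) _ _ Wx Wy) |].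
rewrite -scaleVF; apply: (@memvZ _ _ (bose U)); apply: memv_span.
by apply/allpairsP; exists ((vbasis {:L})`_k, u); rewrite !mem_nth ?size_tuple.
Qed.

Lemma bose_spanned (U : {vspace VL L}) (W : {vspace VF L}) :
  (bose U <= W)%VS <->
  (forall P, is_point P -> (P <= U)%VS -> (bose P <= W)%VS).
Proof.
split=> [UW P _ PU | PW].
  apply: subv_trans UW; apply/subvP => v; rewrite mem_bose => Pv.
  by rewrite mem_bose (subvP PU).
apply/subvP => v; rewrite mem_bose => Uv.
have [->|v0] := eqVneq (v : VL L) 0; first exact: mem0v.
apply: (subvP (PW <[v : VL L]>%VS _ _)); last by rewrite mem_bose memv_line.
  by rewrite /is_point dim_vline v0.
by rewrite -memvE.
Qed.

(* The points whose coordinates in some L-basis e lie in F. *)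
Definition Fq_subplane (S : {vspace VL L} -> Prop) : Prop :=
  exists2 e : 3.-tuple (VL L), basis_of fullv e &
    forall P, S P <-> exists2 a : 'I_3 -> F, (exists i, a i != 0) &
      P = <[\sum_i (a i)%:A *: e`_i]>%VS.

Section Types.
Variables (S : {vspace VL L} -> Prop) (phi : {vspace VL L} -> {vspace VL L}).
Variable sigma : 'End(VF L).

Definition type_I P : Prop := is_point P /\ S P.
Definition type_II P : Prop :=
  is_point P /\ [/\ P <> phi P, P <> phi (phi P) & phi P <> phi (phi P)] /\
  collinear P (phi P) (phi (phi P)).

Definition type_I_line l : Prop :=
  is_line l /\ has_card (fun P => S P /\ (P <= l)%VS) (#|F| + 1)%N.

Definition HI_5space Pi : Prop := exists2 l, type_I_line l & Pi = bose l.

Definition I_point A : Prop :=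
  is_point A /\ exists2 P, type_I P & (A <= bose P)%VS.
Definition II_point A : Prop :=
  is_point A /\ exists2 P, type_II P & (A <= bose P)%VS.

Local Notation s U := (sigma @: U)%VS.

Definition ptwise_fixed_line m : Prop :=
  is_line m /\ forall A, is_point A -> (A <= m)%VS -> s A = A.

Definition I_vdots_point A : Prop :=
  I_point A /\ [/\ A <> s A, A <> s (s A) & s A <> s (s A)] /\
  collinear A (s A) (s (s A)).
Definition II_vdots_point B : Prop :=
  II_point B /\ collinear B (s B) (s (s B)).

Definition fixed_I_line m : Prop :=
  [/\ is_line m, s m = m & exists2 A, I_vdots_point A & (A <= m)%VS].
Definition fixed_II_line m : Prop :=
  [/\ is_line m, s m = m & exists2 B, II_vdots_point B & (B <= m)%VS].

Definition hwise_fixed_5space Pi : Prop :=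
  \dim Pi = 6%N /\ forall H, \dim H = 7%N -> (Pi <= H)%VS -> s H = H.

Definition fixed_lines_in (Sg : {vspace VF L}) m : Prop :=
  (fixed_I_line m \/ fixed_II_line m) /\ (m <= Sg)%VS.

End Types.
End Bose.

(* Main.v *)
(** In coordinates with respect to the subplane, the induced projectivity is
[lambda * tau] for a generator [tau] of the Galois group of [L] over [F].  A
hyperplanewise fixed 5-space forces [sigma] to have an eigenvalue [a] in [F];
after rescaling the frame by an eigenvector, [s = sigma / a] is [tau] acting on
coordinates, and the 5-space is the image of [s - 1].  Its intersection with a
Type-I-line [<u1, u2>] is [{x u1 + y u2 | x, y in T}], [T] the elements of trace
zero.  There [s^2 + s + 1 = 0], and [Sigma3 = a + s a] (direct sum) where
[a = <th u1, th u2>_F] for a [th] in [T] that is not an eigenvector of [tau].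
A point of [Sigma3] not fixed by [s] is a I_vdots- or a II_vdots-point, so the
lines in question are the [s]-invariant lines that are not fixed pointwise, i.e.
the lines [<v, s v>].  Whether [b^2 + b + 1] has no root, a double root or two
roots in [F] decides between the three congruences; the reguli are the sets of
transversals of [a], [s a], [s^2 a]. *)

From HB Require Import structures.
Require Import Defs.
From mathcomp Require Import all_boot all_order all_algebra all_fingroup.
From mathcomp Require Import all_solvable all_field ring.
Set Implicit Arguments.
Unset Strict Implicit.
Unset Printing Implicit Defensive.
Import GRing.Theory FinRing.Theory.
Local Open Scope ring_scope.

(** * Roots of [b^2 + b + 1] in a finite field *)

Section CubeRoots.
Variable F : finFieldType.

(** If 3 divides q, Cauchy's theorem in the additive group gives a nonzero element killed by 3.
    Conversely, if 3 = 0 then 1 has additive order 3 and Lagrange applies. *)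
Lemma card_mod3_char : #|F| = 0 %[mod 3] <-> 1 + 1 + 1 = 0 :> F.
Proof.
rewrite -[1 + 1 + 1]/(1 *+ 2 + 1) -mulrSr mod0n; split=> [q3|t0].
  have [|x _ x3] := @Cauchy _ 3 [set: F]%G isT; first by rewrite cardsT /dvdn q3.
  have x0 : x != 0 by apply/eqP => x0; move: x3; rewrite x0 order1.
  have : x *+ 3 == 0 by rewrite -zmodXgE -x3 expg_order.
  by rewrite -mulr_natr mulf_eq0 (negPf x0) => /eqP.
have o3 : #[1%R : F]%g = 3%N.
  have : (#[1%R : F]%g %| 3)%N by rewrite order_dvdn zmodXgE t0.
  rewrite dvdn_divisors // !inE /= => /orP[|/eqP//].
  by rewrite order_eq1 oner_eq0.
by apply/eqP; rewrite -[_ == _]/(3 %| #|F|)%N -cardsT -o3 order_dvdG ?inE.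
Qed.

Lemma cube_eq1 (b : F) : b ^+ 2 + b + 1 = 0 -> b ^+ 3 = 1.
Proof.
move=> rb; have -> : b ^+ 3 = (b - 1) * (b ^+ 2 + b + 1) + 1 by ring.
by rewrite rb mulr0 add0r.
Qed.

Lemma distinct_roots_sum (b b' : F) : b ^+ 2 + b + 1 = 0 ->
  b' ^+ 2 + b' + 1 = 0 -> b != b' -> b + b' + 1 = 0.
Proof.
move=> rb rb' bb'; have /eqP : (b - b') * (b + b' + 1) = 0.
  by rewrite -[RHS](subrr 0) -{1}rb -rb'; ring.
by rewrite mulf_eq0 subr_eq0 (negPf bb') /= => /eqP.
Qed.

(** A root is a cube root of unity, so [b = b ^ q = b ^ 2]; hence [b = 1] and 3 = 0, which the
    residue of q excludes. *)
Lemma no_root_of_card2mod3 : #|F| = 2 %[mod 3] ->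
  forall b : F, b ^+ 2 + b + 1 != 0.
Proof.
move=> q2 b; apply/eqP => rb; have b3 := cube_eq1 rb.
have := expf_card b; rewrite (divn_eq #|F| 3) q2 exprD mulnC exprM b3 expr1n mul1r.
move=> b2; have /card_mod3_char : 1 + 1 + 1 = 0 :> F; last by rewrite q2.
rewrite -rb b2; suff -> : b = 1 by [].
have b0 : b != 0 by apply: contra_eq_neq b3 => ->; rewrite expr0n eq_sym oner_eq0.
by apply: (mulfI b0); rewrite mulr1 -expr2.
Qed.

Lemma two_roots_of_card1mod3 : #|F| = 1 %[mod 3] ->
  exists b b' : F, [/\ b ^+ 2 + b + 1 = 0, b' ^+ 2 + b' + 1 = 0 & b != b'].
Proof.
move=> q1; have [|u _ u3] := @Cauchy _ 3 [set: {unit F}]%G isT.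
  have /prednK q0 : (0 < #|F|)%N by apply/card_gt0P; exists 0.
  have : #|F|.-1 + 1 == 0 + 1 %[mod 3] by rewrite addn1 q0 q1.
  by rewrite eqn_modDr card_finField_unit.
pose b : F := val u; have b3 : b ^+ 3 = 1 by rewrite -val_unitX -u3 expg_order.
have b1 : b != 1.
  apply/eqP => b1; have u1 : u = 1%g by apply: val_inj.
  by move: u3; rewrite u1 order1.
have rb : b ^+ 2 + b + 1 = 0.
  have /eqP : (b - 1) * (b ^+ 2 + b + 1) = 0.
    have -> : (b - 1) * (b ^+ 2 + b + 1) = b ^+ 3 - 1 by ring.
    by rewrite b3 subrr.
  by rewrite mulf_eq0 subr_eq0 (negPf b1) => /eqP.
exists b, (- 1 - b); split=> //; first by rewrite -[RHS]rb; ring.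
apply/eqP => bb'; have /card_mod3_char : 1 + 1 + 1 = 0 :> F; last by rewrite q1.
(* The squared difference of the roots is the discriminant -3, so a double root would give 3 = 0. *)
have -> : 1 + 1 + 1 = 4 * (b ^+ 2 + b + 1) - (b - (- 1 - b)) ^+ 2 by ring.
by rewrite -bb' subrr rb expr0n mulr0 subr0.
Qed.

End CubeRoots.

(** * Points and lines described by spanning vectors *)

Section Lines.
Variables (K : fieldType) (V : vectType K).
Implicit Types (u v w : V) (l m : {vspace V}).

Lemma mem_joinP u v w :
  reflect (exists c d, w = c *: u + d *: v) (w \in <[u]> + <[v]>)%VS.
Proof.
apply: (iffP memv_addP) => [[x /vlineP[c ->] [y /vlineP[d ->] ->]]|[c [d ->]]].
  by exists c, d.
by exists (c *: u); [apply/vlineP; exists c | exists (d *: v); first by apply/vlineP; exists d].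
Qed.

Lemma mem_joinl u v : u \in (<[u]> + <[v]>)%VS.
Proof. by apply: (subvP (addvSl _ _)); apply: memv_line. Qed.

Lemma mem_joinr u v : v \in (<[u]> + <[v]>)%VS.
Proof. by apply: (subvP (addvSr _ _)); apply: memv_line. Qed.

Lemma join_subv u v l : u \in l -> v \in l -> (<[u]> + <[v]> <= l)%VS.
Proof. by move=> ul vl; rewrite subv_add -!memvE ul. Qed.

Lemma capv_line0 v l : v \notin l -> (<[v]> :&: l = 0)%VS.
Proof.
move=> vl; apply/eqP; rewrite -subv0; apply/subvP=> w /memv_capP[/vlineP[c ->]].
have [->|c0] := eqVneq c 0; first by move=> _; rewrite scale0r mem0v.
by rewrite rpredZeq (negPf c0) /= => vl'; rewrite vl' in vl.
Qed.

Lemma dim_add_line v l : v \notin l -> \dim (l + <[v]>) = (\dim l).+1.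
Proof.
move=> vl; rewrite dimv_disjoint_sum ?(capvC l) ?capv_line0 // dim_vline addnC.
by case: eqP vl => // ->; rewrite mem0v.
Qed.

Lemma dim_join u v : u != 0 -> v \notin <[u]>%VS -> \dim (<[u]> + <[v]>) = 2%N.
Proof. by move=> u0 vu; rewrite dim_add_line // dim_vline u0. Qed.

Lemma subv_dim_eq l m : (l <= m)%VS -> (\dim m <= \dim l)%N -> l = m.
Proof. by move=> lm d; apply/eqP; rewrite eqEdim lm. Qed.

Lemma line_eq_join m u v :
  is_line m -> u \in m -> v \in m -> u != 0 -> v \notin <[u]>%VS ->
  m = (<[u]> + <[v]>)%VS.
Proof.
move=> dm um vm u0 vu; apply/esym/subv_dim_eq; first exact: join_subv.
by rewrite dm dim_join.
Qed.

Lemma nonzero_of_notin_line u v : u \notin <[v]>%VS -> u != 0.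
Proof. by apply: contra => /eqP ->; apply: mem0v. Qed.

Lemma exists_nonzero l : l <> 0%VS -> exists2 v, v \in l & v != 0.
Proof.
move=> /eqP l0; exists (vpick l); first exact: memv_pick.
by rewrite vpick0.
Qed.

Lemma meets_vecP l m : meets l m <-> exists v, [/\ v \in l, v \in m & v != 0].
Proof.
split=> [/exists_nonzero[v /memv_capP[vl vm] v0]|[v [vl vm v0]] lm0].
  by exists v.
by move: v0; rewrite -memv0 -lm0 memv_cap vl vm.
Qed.

Lemma skew_vecP l m : Defs.skew l m <-> forall v, v \in l -> v \in m -> v = 0.
Proof.
split=> [lm v vl vm | lm].
  by apply/eqP; rewrite -memv0 -lm memv_cap vl.
apply/eqP; rewrite -subv0; apply/subvP=> v /memv_capP[vl vm].
by rewrite (lm v) ?mem0v.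
Qed.

Lemma pointP (A : {vspace V}) : is_point A -> exists2 v, v != 0 & A = <[v]>%VS.
Proof.
move=> dA; have [|v vA v0] := @exists_nonzero A.
  by move=> A0; move: dA; rewrite /is_point A0 dimv0.
exists v => //; apply/esym/subv_dim_eq; first by rewrite -memvE.
by rewrite dA dim_vline v0.
Qed.

Lemma is_point_line v : v != 0 -> is_point <[v]>%VS.
Proof. by move=> v0; rewrite /is_point dim_vline v0. Qed.

Lemma point_eq_line (A : {vspace V}) v :
  is_point A -> v \in A -> v != 0 -> A = <[v]>%VS.
Proof.
move=> dA vA v0; apply/esym/subv_dim_eq; first by rewrite -memvE.
by rewrite dA dim_vline v0.
Qed.

Lemma is_line_basis m : is_line m ->
  exists u v, [/\ u != 0, v \notin <[u]>%VS & m = (<[u]> + <[v]>)%VS].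
Proof.
move=> dm; have [|u um u0] := @exists_nonzero m.
  by move=> m0; move: dm; rewrite /is_line m0 dimv0.
have /subvPn[v vm vu] : ~~ (m <= <[u]>)%VS.
  by apply/negP => /dimvS; rewrite dm dim_vline u0.
by exists u, v; split=> //; apply: line_eq_join.
Qed.

Lemma line_cap_dim l m : is_line l -> is_line m -> l <> m -> (\dim (l :&: m) < 2)%N.
Proof.
move=> dl dm lm; rewrite ltnNge; apply/negP => d2; apply: lm.
have <- : (l :&: m = l)%VS by apply: subv_dim_eq; rewrite ?capvSl // dl.
by apply: subv_dim_eq; rewrite ?capvSr // dm.
Qed.

(** Comparing coefficients of [s (u + v)] in the independent vectors [u] and [v] forces equal
    eigenvalues. *)
Lemma eigen_line_scalar (s : 'End(V)) u v :
    u != 0 -> v \notin <[u]>%VS -> s u \in <[u]>%VS -> s v \in <[v]>%VS ->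
  s (u + v) \in <[(u + v)%R]>%VS -> exists b, s u = b *: u /\ s v = b *: v.
Proof.
move=> u0 vu /vlineP[b sub] /vlineP[c svc] /vlineP[d].
rewrite linearD /= sub svc scalerDr => /eqP; rewrite -subr_eq0 opprD addrACA.
rewrite -!scalerBl addr_eq0 => /eqP E.
have cd : c = d.
  apply/eqP; rewrite -subr_eq0; apply: contraNT vu => cd0; apply/vlineP.
  exists (- ((c - d)^-1 * (b - d))).
  by rewrite scaleNr -scalerA E scalerN opprK scalerA mulVf ?scale1r.
have bd : b = d.
  apply/eqP; rewrite -subr_eq0; have /eqP := E.
  by rewrite cd subrr scale0r oppr0 scaler_eq0 (negPf u0) orbF.
by exists b; rewrite cd -bd.
Qed.

End Lines.

(** * Invariant lines of an operator with [s^2 + s + 1 = 0] *)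

Section QuadraticAction.
Variables (K : finFieldType) (V : vectType K) (s : 'End(V)) (Sg : {vspace V}).
Hypothesis s_stable : forall v, v \in Sg -> s v \in Sg.
Hypothesis s_quad : forall v, v \in Sg -> s (s v) = - (s v + v).
Hypothesis dimSg : \dim Sg = 4%N.
Implicit Types (a m : {vspace V}) (u v w x y : V).

Definition inv_line m : Prop :=
  [/\ is_line m, (m <= Sg)%VS, (s @: m = m)%VS &
      exists2 v, v \in m & s v \notin <[v]>%VS].

Lemma s_cube v : v \in Sg -> s (s (s v)) = v.
Proof.
move=> vS; rewrite (s_quad vS) linearN linearD /= (s_quad vS).
by rewrite opprD opprK addrAC subrr add0r.
Qed.

Lemma s_inj0 v : v \in Sg -> s v = 0 -> v = 0.
Proof. by move=> vS sv; rewrite -(s_cube vS) sv !linear0. Qed.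

Lemma dim_s_img a : (a <= Sg)%VS -> \dim (s @: a) = \dim a.
Proof.
move=> aS; apply: limg_dim_eq; apply/skew_vecP => v va.
by rewrite memv_ker => /eqP; apply: s_inj0; apply: (subvP aS).
Qed.

Lemma s_img_sub a : (a <= Sg)%VS -> (s @: a <= Sg)%VS.
Proof. by move=> aS; apply/subvP=> _ /memv_imgP[v va ->]; apply/s_stable/(subvP aS). Qed.

Lemma s_img_eq a : (a <= Sg)%VS -> (s @: a <= a)%VS -> (s @: a = a)%VS.
Proof. by move=> aS sa; apply: subv_dim_eq; rewrite // dim_s_img. Qed.

Lemma inv_line_join v :
  v \in Sg -> s v \notin <[v]>%VS -> inv_line (<[v]> + <[s v]>).
Proof.
move=> vS svv; have v0 : v != 0.
  by apply: contraNneq svv => ->; rewrite linear0 mem0v.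
have mS : (<[v]> + <[s v]> <= Sg)%VS by rewrite join_subv ?s_stable.
split=> //; first exact: dim_join.
  apply: s_img_eq => //; rewrite limgD !limg_line join_subv ?mem_joinr //.
  by rewrite s_quad // rpredN rpredD ?mem_joinl ?mem_joinr.
by exists v; first exact: mem_joinl.
Qed.

(** A moved vector determines its invariant line, so distinct invariant lines can share only
    eigenvectors. *)
Lemma inv_lineE m v : inv_line m -> v \in m -> s v \notin <[v]>%VS ->
  m = (<[v]> + <[s v]>)%VS.
Proof.
move=> [dm _ sm _] vm svv; apply: line_eq_join => //.
  by rewrite -sm memv_img.
by apply: contraNneq svv => ->; rewrite linear0 mem0v.
Qed.

Lemma eigen_root b v : v \in Sg -> v != 0 -> s v = b *: v -> b ^+ 2 + b + 1 = 0.
Proof.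
move=> vS v0 sv; have := s_quad vS; rewrite sv linearZ /= sv => /eqP.
rewrite -subr_eq0 opprK scalerA -{3}[v]scale1r -!scalerDl scaler_eq0 (negPf v0).
by rewrite orbF addrA => /eqP.
Qed.

(** * Coordinates given by a line skew to its image *)

Section Splitting.
Variable a : {vspace V}.
Hypothesis aS : (a <= Sg)%VS.
Hypothesis dima : is_line a.
Hypothesis skew_a : Defs.skew a (s @: a)%VS.

Lemma split_sum : (a + s @: a = Sg)%VS.
Proof.
apply: subv_dim_eq; first by rewrite subv_add aS s_img_sub.
by rewrite dimSg dimv_disjoint_sum // dim_s_img // dima.
Qed.

Lemma splitP v : v \in Sg -> exists x y, [/\ x \in a, y \in a & v = x + s y].
Proof.
by rewrite -split_sum => /memv_addP[x xa [_ /memv_imgP[y ya ->] ->]]; exists x, y.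
Qed.

Lemma split0 x y : x \in a -> y \in a -> x + s y = 0 -> x = 0 /\ y = 0.
Proof.
move=> xa ya /eqP; rewrite addr_eq0 => /eqP xE.
have x0 : x = 0.
  by move/skew_vecP: skew_a; apply; rewrite // xE rpredN memv_img.
split=> //; apply: s_inj0; first exact: (subvP aS).
by apply/eqP; rewrite -oppr_eq0 -xE x0.
Qed.

Lemma split_inj x y x' y' : x \in a -> y \in a -> x' \in a -> y' \in a ->
  x + s y = x' + s y' -> x = x' /\ y = y'.
Proof.
move=> xa ya xa' ya' /eqP; rewrite -subr_eq0 opprD addrACA -linearB => /eqP.
by case/split0; rewrite ?rpredB // => /subr0_eq -> /subr0_eq ->.
Qed.

Lemma moved_split w : w \in a -> w != 0 -> s w \notin <[w]>%VS.
Proof.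
move=> wa w0; apply/negP=> /vlineP[c swE]; case/negP: w0.
have cwa : - (c *: w) \in a by rewrite rpredN rpredZ.
by have [|_ ->//] := split0 cwa wa; rewrite swE addNr.
Qed.

(* The regulus opposite to [a], [s a], [s^2 a]: its members join [w] to [s w],
   because [s^2 w = - (s w + w)] is the third intersection point. *)
Lemma regulus_split :
  regulus Sg (fun m => exists w, [/\ w \in a, w != 0 & m = (<[w]> + <[s w]>)%VS]).
Proof.
have bS := s_img_sub aS; have cS := s_img_sub bS.
have memS w : w \in a -> w \in Sg by apply: (subvP aS).
exists a, (s @: a)%VS, (s @: (s @: a))%VS; split; [|split].
- by split; split; rewrite /is_line ?dim_s_img.
- split=> //; apply/skew_vecP => v.
    move=> va /memv_imgP[_ /memv_imgP[y ya ->] vE].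
    have [|_ y0] := @split0 (v + y) y (rpredD va ya) ya.
      by rewrite vE (s_quad (memS _ ya)) opprD addrNK addNr.
    by rewrite vE y0 !linear0.
  move=> /memv_imgP[x xa vE] /memv_imgP[_ /memv_imgP[y ya ->] vE'].
  have nxa : - x \in a by rewrite rpredN.
  have [|_ y0] := split0 nxa ya.
    apply: s_inj0; first by rewrite rpredD ?rpredN ?s_stable ?memS.
    by rewrite linearD linearN /= -vE -vE' addNr.
  by rewrite vE' y0 !linear0.
move=> m; split=> [[w [wa w0 ->]]|[[dm mS] [ma mb mc]]].
  have [dm mS sm _] := inv_line_join (memS _ wa) (moved_split wa w0).
  have sw0 : s w != 0 by apply: contraNneq w0 => /(s_inj0 (memS _ wa)) ->.
  split; [by [] | split; apply/meets_vecP].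
  - by exists w; rewrite mem_joinl.
  - by exists (s w); rewrite mem_joinr memv_img.
  exists (s (s w)); split; [by rewrite -sm memv_img ?mem_joinr | by rewrite !memv_img |].
  by apply: contraNneq sw0 => /(s_inj0 (s_stable (memS _ wa))) ->.
have {ma} [x [xm xa x0]] := (meets_vecP m a).1 ma.
have {mb} [y' [ym /memv_imgP[y ya yE] y0]] := (meets_vecP _ _).1 mb.
rewrite {y'}yE in ym y0.
have {mc} [z' [zm /memv_imgP[_ /memv_imgP[z za ->] zE] z0]] := (meets_vecP _ _).1 mc.
rewrite {z'}zE in zm z0.
have zn0 : z != 0 by apply: contraNneq z0 => ->; rewrite !linear0.
have yx : s y \notin <[x]>%VS.
  apply: contra y0 => /vlineP[c E]; rewrite E.
  have cxa : - (c *: x) \in a by rewrite rpredN rpredZ.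
  by have [|_ y0] := split0 cxa ya; rewrite -E ?addNr // y0 linear0.
have mE := line_eq_join dm xm ym x0 yx.
have [c [d]] : exists c d, s (s z) = c *: x + d *: s y by apply/mem_joinP; rewrite -mE.
have cdE (r : K) v : v \in a -> r *: v \in a by move=> va; rewrite rpredZ ?va.
(* Since [s (s z) = - (z + s z)], comparing components in [a] and [s @: a] makes [z] a multiple of
   [x] and of [y], so [m] contains both [z] and [s z]. *)
rewrite s_quad ?memS // addrC opprD -linearN -linearZ => /split_inj.
case; rewrite ?rpredN ?cdE // => zx zy.
have zm' : z \in m by rewrite -[z]opprK zx rpredN rpredZ ?xm.
have szm : s z \in m by rewrite -[z]opprK zy -scaleNr linearZ rpredZ ?ym.
by exists z; split=> //; apply: line_eq_join => //; apply: moved_split.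
Qed.

Lemma inv_line_split w : w \in a -> w != 0 -> inv_line (<[w]> + <[s w]>).
Proof. by move=> wa w0; apply: inv_line_join; [apply: (subvP aS) | apply: moved_split]. Qed.

(** For a root [b], the other root b' (equal to [b] if double) is its inverse. So [\1 - b *: s] is
    proportional to s - b', and its image is killed by s - b. *)
Definition eigenline b := ((\1 - b *: s)%VF @: a)%VS.

Lemma mem_eigenline b v : b ^+ 2 + b + 1 = 0 ->
  reflect (v \in Sg /\ s v = b *: v) (v \in eigenline b).
Proof.
move=> rb; have memS w : w \in a -> w \in Sg by apply: (subvP aS).
have bE x : b *: (b *: x) = - (b *: x + x).
  apply/eqP; rewrite -subr_eq0 opprK -{3}[x]scale1r scalerA -!scalerDl addrA.
  by rewrite rb scale0r.
apply: (iffP memv_imgP) => [[x xa ->]|[vS]].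
  rewrite !lfunE /= !lfunE /= !lfunE /=; split.
    by rewrite rpredB ?rpredZ ?s_stable ?memS.
  rewrite linearB linearZ /= s_quad ?memS // scalerN opprK scalerBr bE opprK.
  by rewrite scalerDr [LHS]addrC [b *: s x + b *: x]addrC addrA.
have [x [y [xa ya ->]]] := splitP vS.
rewrite linearD /= s_quad ?memS // => E.
have cE v' : v' \in a -> b *: v' \in a by move=> va; rewrite rpredZ ?va.
have : - y + s (x - y) = b *: x + s (b *: y).
  by rewrite linearB linearZ /= -scalerDr -E opprD addrC addrA.
(* The [a]-component of the eigenvector equation reads [- y = b *: x], so the vector is the image of
   [x]. *)
case/split_inj; rewrite ?rpredN ?rpredB ?cE // => yE _.
exists x => //; rewrite !lfunE /= !lfunE /= !lfunE /= -linearZ /= -yE.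
by rewrite linearN opprK.
Qed.

Lemma dim_eigenline b : is_line (eigenline b).
Proof.
rewrite /is_line -dima; apply: limg_dim_eq; apply/skew_vecP => x xa.
rewrite memv_ker !lfunE /= !lfunE /= !lfunE /= -scaleNr -linearZ => /eqP/split0.
by case; rewrite // rpredZ ?xa.
Qed.

Lemma eigenline_sub b : b ^+ 2 + b + 1 = 0 -> (eigenline b <= Sg)%VS.
Proof. by move=> rb; apply/subvP=> v /(mem_eigenline _ rb)[]. Qed.

(** Two spanning vectors and their sum are eigenvectors, hence share one eigenvalue; the line then
    lies in an eigenline of the same dimension. *)
Lemma ptwise_fixed_eigenline m : is_line m -> (m <= Sg)%VS ->
    (forall v, v \in m -> s v \in <[v]>%VS) ->
  exists2 b, b ^+ 2 + b + 1 = 0 & m = eigenline b.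
Proof.
move=> dm mS fixm; have [u [v [u0 vu mE]]] := is_line_basis dm.
have [um vm] : u \in m /\ v \in m by rewrite mE mem_joinl mem_joinr.
have [b [sub svb]] := eigen_line_scalar u0 vu (fixm u um) (fixm v vm) (fixm _ (rpredD um vm)).
have rb : b ^+ 2 + b + 1 = 0 by apply: (eigen_root _ u0 sub); apply: (subvP mS).
exists b => //; apply: subv_dim_eq; last by rewrite dm dim_eigenline.
rewrite mE join_subv //; apply/(mem_eigenline _ rb); split=> //; exact: (subvP mS).
Qed.

(** An invariant line with a moved vector contains an eigenvector for each of [b] and [b'], and
    conversely two such eigenvectors span an invariant line. *)
Lemma hyperbolic_inv_lines (C : {vspace V} -> Prop) b b' :
  (forall m, C m <-> inv_line m) -> b ^+ 2 + b + 1 = 0 -> b' ^+ 2 + b' + 1 = 0 ->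
  b != b' -> hyperbolic_congruence Sg C (eigenline b) (eigenline b').
Proof.
move=> CE rb rb' bb'.
have bb'S := distinct_roots_sum rb rb' bb'.
have bb'P : b * b' = 1.
  have -> : b * b' = 1 + (b + b' + 1) * b - (b ^+ 2 + b + 1) by ring.
  by rewrite bb'S rb mul0r subr0 addr0.
split; try by split; [exact: dim_eigenline | exact: eigenline_sub].
  apply/skew_vecP => v /(mem_eigenline _ rb)[vS svb] /(mem_eigenline _ rb')[_].
  rewrite svb => /eqP; rewrite -subr_eq0 -scalerBl scaler_eq0 subr_eq0.
  by rewrite (negPf bb') => /eqP.
(* Because (s - c)(s - c') = s^2 + s + 1 vanishes on [Sg], applying s - c' to a moved vector gives a
   point of the axis for [c]. *)
have shift_eigen c c' v : v \in Sg -> c + c' + 1 = 0 -> c * c' = 1 ->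
    s (s v - c' *: v) = c *: (s v - c' *: v).
  move=> vS S1 P1; rewrite linearB linearZ /= s_quad // scalerBr scalerA P1 scale1r.
  have -> : c = - (1 + c') by apply/eqP; rewrite -addr_eq0 addrA addrAC S1.
  by rewrite scaleNr scalerDl scale1r -!opprD addrAC.
move=> m; rewrite CE; split=> [Cm|[[dm mS] /meets_vecP[v1 [v1m]]]].
  have [dm mS sm [v vm svv]] := Cm; have vS : v \in Sg by apply: (subvP mS).
  have nz c : s v - c *: v != 0.
    by apply: contra svv; rewrite subr_eq0 => /eqP ->; rewrite rpredZ // memv_line.
  have mm c : s v - c *: v \in m by rewrite rpredB ?rpredZ // -sm memv_img.
  split=> //; apply/meets_vecP.
    exists (s v - b' *: v); split=> //; apply/(mem_eigenline _ rb).
    by rewrite (@shift_eigen b b') // (subvP mS).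
  exists (s v - b *: v); split=> //; apply/(mem_eigenline _ rb').
  by rewrite (@shift_eigen b' b) // ?(subvP mS) // 1?mulrC // (addrC b').
move=> /(mem_eigenline _ rb)[v1S sv1] v10.
move=> /meets_vecP[v2 [v2m /(mem_eigenline _ rb')[v2S sv2] v20]].
have sv : s (v1 + v2) = b *: v1 + b' *: v2 by rewrite linearD /= sv1 sv2.
have v2v1 : v2 \notin <[v1]>%VS.
  apply/negP => /vlineP[c v2E]; case/negP: v20.
  have /eqP : (b - b') *: v2 = 0.
    by rewrite scalerBl -sv2 {2}v2E linearZ /= sv1 scalerA mulrC -scalerA -v2E subrr.
  by rewrite scaler_eq0 subr_eq0 (negPf bb').
(* If [v1 + v2] were an eigenvector, independence of [v1] and [v2] would force [b = b']. *)
have mv : s (v1 + v2) \notin <[v1 + v2]>%VS.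
  rewrite sv; apply/negP => /vlineP[c] /eqP.
  rewrite -subr_eq0 scalerDr opprD addrACA -!scalerBl addr_eq0 => /eqP E.
  have b'c : b' = c.
    apply/eqP; rewrite -subr_eq0; apply: contraNT v2v1 => cd0; apply/vlineP.
    exists (- ((b' - c)^-1 * (b - c))).
    by rewrite scaleNr -scalerA E scalerN opprK scalerA mulVf ?scale1r.
  have /eqP := E; rewrite b'c subrr scale0r oppr0 scaler_eq0 (negPf v10) orbF.
  by rewrite subr_eq0 -b'c (negPf bb').
have vS : v1 + v2 \in Sg by rewrite rpredD.
rewrite (@line_eq_join _ _ m (v1 + v2) (s (v1 + v2))) //.
- exact: inv_line_join.
- by rewrite rpredD.
- by rewrite sv rpredD ?rpredZ.
by apply: contraNneq mv => ->; rewrite linear0 mem0v.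
Qed.

(** * The parabolic case: characteristic 3 *)

Section Unipotent.
Hypothesis char3 : 1 + 1 + 1 = 0 :> K.

(* In characteristic 3 the relation [s^2 + s + 1 = 0] reads [nilp ^ 2 = 0]. *)
Definition nilp : 'End(V) := (s - \1)%VF.

Let l := eigenline 1.

Let root1 : (1 : K) ^+ 2 + 1 + 1 = 0. Proof. by rewrite expr1n. Qed.

Let aSg x : x \in a -> x \in Sg. Proof. exact: (subvP aS). Qed.

Let aZ (c : K) x : x \in a -> c *: x \in a. Proof. by move=> xa; rewrite rpredZ. Qed.

Lemma nilpE x : nilp x = s x - x.
Proof. by rewrite !lfunE /= !lfunE /= id_lfunE. Qed.

Lemma s_nilp x : x \in Sg -> s (nilp x) = nilp x.
Proof.
move=> xS; rewrite nilpE linearB /= s_quad // addrC opprD addrA; congr (_ - _).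
apply/eqP; rewrite -subr_eq0 -!opprD oppr_eq0; apply/eqP.
by rewrite -[s x]scale1r -!scalerDl char3 scale0r.
Qed.

(** Since [x + s y = (x + y) + nilp y], the map [nilp] can replace [s] in the coordinates. *)
Lemma nilp_split v : v \in Sg ->
  exists x y, [/\ x \in a, y \in a & v = x + nilp y].
Proof.
move=> /splitP[x [y [xa ya ->]]]; exists (x + y), y; split; rewrite ?rpredD //.
by rewrite nilpE [s y - y]addrC addrA addrK.
Qed.

Lemma nilp_split0 x y : x \in a -> y \in a -> x + nilp y = 0 -> x = 0 /\ y = 0.
Proof.
move=> xa ya; rewrite nilpE [s y - y]addrC addrA => /(split0 (rpredB xa ya) ya)[+ y0].
by rewrite y0 subr0.
Qed.

Lemma nilp_split_inj x y x' y' : x \in a -> y \in a -> x' \in a -> y' \in a ->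
  x + nilp y = x' + nilp y' -> x = x' /\ y = y'.
Proof.
move=> xa ya xa' ya' /eqP; rewrite -subr_eq0 opprD addrACA -linearB => /eqP.
by case/nilp_split0; rewrite ?rpredB // => /subr0_eq -> /subr0_eq ->.
Qed.

Lemma nilp_in_eigenline x : x \in Sg -> nilp x \in l.
Proof.
move=> xS; apply/(mem_eigenline _ root1); rewrite s_nilp // scale1r; split=> //.
by rewrite nilpE rpredB ?s_stable.
Qed.

Lemma s_nilp_split x y : x \in a -> y \in a ->
  s (x + nilp y) = x + nilp y + nilp x.
Proof.
move=> xa ya; rewrite linearD /= s_nilp ?aSg // [nilp x]nilpE.
by rewrite [RHS]addrC addrA subrK.
Qed.

Lemma nilp_split_Sg x y : x \in a -> y \in a -> x + nilp y \in Sg.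
Proof. by move=> xa ya; rewrite rpredD ?nilpE ?rpredB ?s_stable ?aSg. Qed.

(** For [v = x + nilp y] one has [s v = v + nilp x]. So the line depends only on the pair of [x] and
    [y] up to a common scalar, and on [y] modulo [x]. *)
Lemma nilp_join x y w : x \in a -> y \in a ->
  w \in (<[(x + nilp y)%R]> + <[s (x + nilp y)%R]>)%VS <->
  exists c d, w = c *: x + nilp (c *: y + d *: x).
Proof.
move=> xa ya; rewrite s_nilp_split //; split=> [/mem_joinP[c [d ->]]|[c [d ->]]].
  exists (c + d), d; rewrite [d *: _]scalerDr addrA -scalerDl scalerDr.
  by rewrite linearD !linearZ /= addrA.
apply/mem_joinP; exists (c - d), d.
rewrite [d *: (_ + nilp x)]scalerDr addrA -scalerDl subrK linearD !linearZ /=.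
by rewrite scalerDr addrA.
Qed.

Lemma nilp_moved x y : x \in a -> y \in a ->
  (s (x + nilp y) \notin <[(x + nilp y)%R]>%VS) = (x != 0).
Proof.
move=> xa ya; rewrite s_nilp_split //; apply/idP/idP.
  by apply: contraNneq => ->; rewrite linear0 addr0 memv_line.
apply: contraNN => /vlineP[c E]; apply/eqP.
have [|xE yE] := nilp_split_inj xa (rpredD ya xa) (aZ c xa) (aZ c ya).
  by rewrite linearD addrA E scalerDr linearZ.
have [//|x0] := eqVneq x 0.
have c1 : c = 1.
  apply/eqP; rewrite -subr_eq0; have : (c - 1) *: x == 0.
    by rewrite scalerBl scale1r -xE subrr.
  by rewrite scaler_eq0 (negPf x0) orbF.
by move: yE; rewrite c1 scale1r => /(canRL (addKr _)); rewrite addNr.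
Qed.

Lemma eigenline1_not_inv : ~ inv_line l.
Proof.
move=> [_ _ _ [v /(mem_eigenline _ root1)[_ ->]]].
by rewrite scale1r memv_line.
Qed.

(* A line [<v, s v>] with [v = x + nilp y] is normalised by rescaling [x] to
   [w1 + t w2] or to [w2], and then reducing [y] modulo [x]. *)
Lemma card_inv_lines : has_card inv_line (#|K| ^ 2 + #|K|)%N.
Proof.
have [w1 [w2 [w10 w21 aE]]] := is_line_basis dima.
have [w1a w2a] : w1 \in a /\ w2 \in a by rewrite aE mem_joinl mem_joinr.
have w20 := nonzero_of_notin_line w21.
have coef0 c d : c *: w1 + d *: w2 = 0 -> c = 0 /\ d = 0.
  move=> E; have d0 : d = 0.
    apply/eqP; apply: contraNT w21 => d0; apply/vlineP; exists (- (d^-1 * c)).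
    move/eqP: E; rewrite addrC addr_eq0 => /eqP E.
    by rewrite scaleNr -scalerA -scalerN -E scalerA mulVf ?scale1r.
  by move/eqP: E; rewrite d0 scale0r addr0 scaler_eq0 (negPf w10) orbF => /eqP.
have coef c d c' d' : c *: w1 + d *: w2 = c' *: w1 + d' *: w2 -> c = c' /\ d = d'.
  move=> /eqP; rewrite -subr_eq0 opprD addrACA -!scalerBl => /eqP/coef0[].
  by move=> /subr0_eq -> /subr0_eq ->.
pose J v := (<[v]> + <[s v]>)%VS.
(* Modulo [x], the vector [y] reduces to a multiple of [w2] when [x = w1 + t *: w2], and of [w1]
   when [x = w2]; this gives q^2 and q lines. *)
pose v1 t r := w1 + t *: w2 + nilp (r *: w2).
pose v2 r := w2 + nilp (r *: w1).
have x1a t : w1 + t *: w2 \in a by rewrite rpredD ?aZ.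
have x10 t : w1 + t *: w2 != 0.
  by apply/eqP; rewrite -[w1]scale1r => /coef0[/eqP]; rewrite oner_eq0.
have joinE x y x' y' : x \in a -> y \in a -> x' \in a -> y' \in a ->
    J (x + nilp y) = J (x' + nilp y') ->
    exists c d, x = c *: x' /\ y = c *: y' + d *: x'.
  move=> xa ya xa' ya' E; have : x + nilp y \in J (x + nilp y) by apply: mem_joinl.
  rewrite E => /nilp_join[]// c [d] E'.
  by exists c, d; apply: nilp_split_inj E'; rewrite ?rpredD ?aZ.
pose s1 := [seq J (v1 t r) | t <- enum K, r <- enum K].
pose s2 := [seq J (v2 r) | r <- enum K].
exists (s1 ++ s2); split.
- rewrite cat_uniq; apply/and3P; split.
  + apply: allpairs_uniq; rewrite ?enum_uniq // => -[t r] [t' r'] _ _ /= E.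
    have [||||c [d [+ +]]] := joinE _ _ _ _ _ _ _ _ E; rewrite ?x1a ?aZ //.
    rewrite -{1}[w1]scale1r scalerDr scalerA => /coef[<-]; rewrite mul1r => ->.
    rewrite scale1r -{1}[r *: w2]add0r -{1}(scale0r w1) scalerDr addrCA scalerA -scalerDl.
    by move=> /coef[<-]; rewrite mul0r addr0 => ->.
  + apply/hasPn => _ /mapP[r _ ->]; apply/allpairsP => -[[t r'] /= [_ _ E]].
    have [||||c [d [+ _]]] := joinE _ _ _ _ _ _ _ _ E; rewrite ?x1a ?aZ //.
    rewrite -{1}[w2]add0r -{1}(scale0r w1) -{1}[w2]scale1r scalerDr scalerA.
    by move=> /coef[<- /eqP]; rewrite mul0r oner_eq0.
  rewrite map_inj_uniq ?enum_uniq // => r r' E.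
  have [||||c [d [+ +]]] := joinE _ _ _ _ _ _ _ _ E; rewrite ?aZ //.
  rewrite -{1}[w2]scale1r => /eqP; rewrite -subr_eq0 -scalerBl scaler_eq0.
  rewrite (negPf w20) orbF subr_eq0 => /eqP <-; rewrite scale1r.
  by rewrite -[r *: w1]addr0 -{1}(scale0r w2) => /coef[->].
- by rewrite size_cat size_allpairs [size s2]size_map -cardE mulnn.
move=> m; rewrite mem_cat; split=> [/orP[/allpairsP[[t r] [_ _ ->]]|/mapP[r _ ->]]|mi].
- by apply: inv_line_join; rewrite /= ?nilp_split_Sg ?nilp_moved ?aZ.
- by apply: inv_line_join; rewrite /= ?nilp_split_Sg ?nilp_moved ?aZ.
have [_ mS _ [v vm]] := mi; have [x [y [xa ya vE]]] := nilp_split (subvP mS _ vm).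
rewrite vE => mv; rewrite vE in vm; move: (mv); rewrite nilp_moved // => x0.
have mE := inv_lineE mi vm mv.
have mJ c d : c != 0 -> m = J (c *: x + nilp (c *: y + d *: x)).
  move=> c0; apply: inv_lineE => //; first by rewrite mE; apply/nilp_join => //; exists c, d.
  by rewrite nilp_moved ?rpredD ?aZ // scaler_eq0 negb_or c0.
have /mem_joinP[c1 [c2 xE]] : x \in (<[w1]> + <[w2]>)%VS by rewrite -aE.
have /mem_joinP[c3 [c4 yE]] : y \in (<[w1]> + <[w2]>)%VS by rewrite -aE.
have [c10|c10] := eqVneq c1 0.
  have c20 : c2 != 0.
    by apply: contraNneq x0 => c20; rewrite xE c10 c20 !scale0r addr0.
  apply/orP; right; apply/mapP; exists (c2^-1 * c3); rewrite ?mem_enum //.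
  (* The second parameter is the multiple of [x] that cancels the [w2]-part of [y]. *)
  rewrite (mJ c2^-1 (- (c2^-1 * (c4 / c2)))) ?invr_eq0 //; congr J.
  rewrite xE yE c10 scale0r add0r /v2 scalerA mulVf // scale1r; congr (_ + nilp _).
  rewrite scalerDr !scalerA mulNr -mulrA divfK // scaleNr -addrA.
  by rewrite subrr addr0.
apply/orP; left; apply/allpairsP.
exists (c1^-1 * c2, c1^-1 * c4 - c1^-1 * (c3 / c1) * c2); split; rewrite ?mem_enum //=.
(* Here [x] gets [w1]-coefficient 1, and the multiple of [x] cancels the [w1]-part of [y]. *)
rewrite (mJ c1^-1 (- (c1^-1 * (c3 / c1)))) ?invr_eq0 //; congr J.
rewrite xE yE /v1 !scalerDr !scalerA mulVf // scale1r; congr (_ + nilp _).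
by rewrite addrACA -!scalerDl !mulNr -[_ * c1]mulrA divfK // subrr scale0r add0r.
Qed.

(** An invariant line meets the axis in [nilp v] for any moved [v] on it. The count comes from
    [card_inv_lines] and the regulus from [regulus_split]. *)
Lemma parabolic_inv_lines (C : {vspace V} -> Prop) :
  (forall m, C m <-> inv_line m) ->
  parabolic_congruence Sg (fun m => C m \/ m = l) l.
Proof.
move=> CE; have dl : is_line l := dim_eigenline 1.
have lS : (l <= Sg)%VS by apply: eigenline_sub.
have [sq [sq_uniq sq_size sqE]] := card_inv_lines.
split; [by [] | split].
  exists (l :: sq); split=> [/=||U].
  - by rewrite sq_uniq andbT; apply/negP => /sqE/eigenline1_not_inv.
  - by rewrite /= sq_size addn1.
  rewrite inE; split=> [/orP[/eqP|/sqE]|[/CE/sqE ->|->]]; rewrite ?eqxx ?orbT //.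
    by right.
  by left; apply/CE.
exists inv_line; split.
- by move=> m; rewrite CE; split=> [[]|[]]; auto.
- exact: card_inv_lines.
- move=> m mi; have [dm mS sm [v vm mv]] := mi; split=> //; apply/meets_vecP.
  exists (nilp v); split.
  + by rewrite nilpE rpredB // -sm memv_img.
  + by apply: nilp_in_eigenline; apply: (subvP mS).
  by apply: contra mv; rewrite nilpE subr_eq0 => /eqP ->; apply: memv_line.
- move=> m m' mi mi' mm'; have [dm mS _ _] := mi; have [dm' _ _ _] := mi'.
  have capl : (m :&: m' <= l)%VS.
    apply/subvP => v /memv_capP[vm vm']; have vS : v \in Sg by apply: (subvP mS).
    apply/(mem_eigenline _ root1); split=> //; rewrite scale1r.
    (* An eigenvalue is a root of (b - 1)^2, hence 1; a moved common vector would make the two lines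
       equal. *)
    have [/vlineP[b svb]|mv] := boolP (s v \in <[v]>%VS).
      have [->|v0] := eqVneq v 0; first by rewrite linear0.
      have /eqP := eigen_root vS v0 svb.
      have -> : b ^+ 2 + b + 1 = (b - 1) ^+ 2 + (1 + 1 + 1) * b by ring.
      by rewrite char3 mul0r addr0 sqrf_eq0 subr_eq0 svb => /eqP ->; rewrite scale1r.
    by case: mm'; rewrite (inv_lineE mi vm mv) (inv_lineE mi' vm' mv).
  have := line_cap_dim dm dm' mm'; case E: (\dim _) => [|[|//]] _; last by right.
  by left; apply/eqP; rewrite -dimv_eq0 E.
exists (fun m => exists w, [/\ w \in a, w != 0 & m = (<[w]> + <[s w]>)%VS]).
split; first exact: regulus_split.
by move=> m [w [wa w0 ->]]; apply: inv_line_split.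
Qed.

End Unipotent.

End Splitting.

(** Without eigenvectors, [<v, s v>] is the only member through [v]. Three members have a common
    transversal [a'] skew to its image, so [regulus_split] applies to [a']. *)
Lemma elliptic_inv_lines (C : {vspace V} -> Prop) :
  (forall m, C m <-> inv_line m) -> (forall b : K, b ^+ 2 + b + 1 != 0) ->
  elliptic_congruence Sg C.
Proof.
move=> CE noroot.
have moved v : v \in Sg -> v != 0 -> s v \notin <[v]>%VS.
  move=> vS v0; apply/negP=> /vlineP[b svb]; have /eqP := noroot b; apply.
  exact: eigen_root svb.
have CS m v : C m -> v \in m -> v \in Sg by move=> /CE[_ mS _ _]; apply: (subvP mS).
have uniqC m v : C m -> v \in m -> v != 0 -> m = (<[v]> + <[s v]>)%VS.
  move=> Cm vm v0; apply: (@inv_lineE m v) => //; first exact/CE.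
  by apply: moved => //; apply: CS vm.
have skewC m m' : C m -> C m' -> m <> m' -> Defs.skew m m'.
  move=> Cm Cm' mm'; apply/skew_vecP => v vm vm'; apply/eqP; apply: contra_notT mm' => v0.
  by rewrite (uniqC m v Cm vm v0); apply/esym/uniqC.
split.
  split=> [m /CE[]|P /pointP[v v0 ->]]; rewrite ?/line_of -?memvE // => vS.
  exists (<[v]> + <[s v]>)%VS; split=> [|m [Cm vm]].
    by rewrite -memvE mem_joinl; split=> //; apply/CE/inv_line_join/moved.
  by rewrite -memvE in vm; apply/esym/uniqC.
move=> l1 l2 l3 C1 C2 C3 n12 n13 n23.
have [d1 S1 s1 _] := (CE _).1 C1; have [d2 S2 s2 _] := (CE _).1 C2.
have [d3 _ _ _] := (CE _).1 C3.
have sum12 : (l1 + l2 = Sg)%VS.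
  apply: subv_dim_eq; first by rewrite subv_add S1.
  by rewrite dimSg dimv_disjoint_sum ?(skewC l1 l2) // d1 d2.
have [v3 [v3' [v30 _ l3E]]] := is_line_basis d3.
have v3m : v3 \in l3 by rewrite l3E mem_joinl.
(* Splitting a vector of [l3] along [l1 + l2] yields a line [<v1, v2>] meeting all three lines. *)
have /memv_addP[v1 v1m [v2 v2m v3E]] : v3 \in (l1 + l2)%VS by rewrite sum12 (CS l3).
have v10 : v1 != 0.
  apply: contraNneq v30 => v10; apply/eqP.
  apply: (skew_vecP _ _).1 (skewC _ _ C2 C3 n23) _ _ v3m.
  by rewrite v3E v10 add0r.
have v20 : v2 != 0.
  apply: contraNneq v30 => v20; apply/eqP.
  apply: (skew_vecP _ _).1 (skewC _ _ C1 C3 n13) _ _ v3m.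
  by rewrite v3E v20 addr0.
have /skew_vecP sk12 := skewC _ _ C1 C2 n12.
have v2v1 : v2 \notin <[v1]>%VS.
  apply/negP => /vlineP[c v2E]; case/negP: v20; apply/eqP; apply: sk12 => //.
  by rewrite v2E rpredZ.
have [v1S v2S] : v1 \in Sg /\ v2 \in Sg by rewrite (CS l1) ?(CS l2).
pose a' := (<[v1]> + <[v2]>)%VS.
have aS' : (a' <= Sg)%VS by rewrite join_subv.
have da' : is_line a' by apply: dim_join.
have sk' : Defs.skew a' (s @: a')%VS.
  apply/skew_vecP => v /mem_joinP[c [d ->]] /memv_imgP[_ /mem_joinP[c' [d' ->]]].
  rewrite linearD !linearZ /= => /eqP; rewrite -subr_eq0 opprD addrACA addr_eq0 => /eqP E.
  have sm i v' : (s @: i)%VS = i -> v' \in i -> s v' \in i by move=> si ?; rewrite -si memv_img.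
  (* The equation separates into parts in the skew lines [l1] and [l2]. Both vanish, and so do the
     coefficients because [v1] and [v2] are moved. *)
  have in1 : c *: v1 - c' *: s v1 \in l1 by rewrite rpredB ?rpredZ ?sm.
  have in2 : d *: v2 - d' *: s v2 \in l2 by rewrite rpredB ?rpredZ ?sm.
  have z1 : c *: v1 - c' *: s v1 = 0 by apply: sk12 => //; rewrite E rpredN.
  have z2 : d *: v2 - d' *: s v2 = 0.
    by apply/eqP; rewrite -oppr_eq0 -E z1.
  have coef w e e' : w \in Sg -> w != 0 -> e *: w - e' *: s w = 0 -> e = 0.
    move=> wS w0 /eqP; rewrite subr_eq0 => /eqP Ew.
    have e'0 : e' = 0.
      apply/eqP; apply: contraNT (moved w wS w0) => e'0; apply/vlineP.
      by exists (e'^-1 * e); rewrite -scalerA Ew scalerA mulVf ?scale1r.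
    by move/eqP: Ew; rewrite e'0 scale0r scaler_eq0 (negPf w0) orbF => /eqP.
  by rewrite (coef _ _ _ v1S v10 z1) (coef _ _ _ v2S v20 z2) !scale0r addr0.
have memR w m : C m -> w \in m -> w != 0 -> w \in a' ->
    exists w, [/\ w \in a', w != 0 & m = (<[w]> + <[s w]>)%VS].
  by move=> Cm wm w0 wa; exists w; split=> //; apply: uniqC.
exists (fun m => exists w, [/\ w \in a', w != 0 & m = (<[w]> + <[s w]>)%VS]); split.
- exact: regulus_split.
- by apply: (memR v1); rewrite ?mem_joinl.
- by apply: (memR v2); rewrite ?mem_joinr.
- by apply: (memR v3) => //; rewrite v3E rpredD ?mem_joinl ?mem_joinr.
by move=> m [w [wa w0 ->]]; apply/CE/inv_line_join/moved => //; apply: (subvP aS').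
Qed.

End QuadraticAction.

(** * Maps fixing every subspace one dimension above [Pi] *)

Section HyperplanewiseFixed.
Variables (K : fieldType) (V : vectType K) (s : 'End(V)) (Pi : {vspace V}).
Hypothesis codimPi : ((\dim Pi).+1 < \dim {:V})%N.
Hypothesis hfix : forall H : {vspace V},
  \dim H = (\dim Pi).+1 -> (Pi <= H)%VS -> (s @: H = H)%VS.

(* Two vectors independent modulo [Pi] have the same eigenvalue modulo [Pi]. *)
Lemma hwise_fixed_scalar : exists a, forall v, s v - a *: v \in Pi.
Proof.
have eig v : v \notin Pi -> exists c, s v - c *: v \in Pi.
  move=> vPi; have sH := hfix (dim_add_line vPi) (addvSl _ _).
  have : s v \in (Pi + <[v]>)%VS.
    by rewrite -sH memv_img // (subvP (addvSr _ _)) ?memv_line.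
  case/memv_addP=> p pPi [_ /vlineP[c ->] ->]; exists c.
  by rewrite addrK.
have /subvPn[x _ xPi] : ~~ ({:V} <= Pi)%VS.
  by apply/negP => /dimvS; rewrite leqNgt (ltn_trans _ codimPi).
have [a xa] := eig x xPi; exists a.
have indep v : v \notin (Pi + <[x]>)%VS -> s v - a *: v \in Pi.
  move=> vx; have xPx : x \in (Pi + <[x]>)%VS.
    by rewrite (subvP (addvSr _ _)) ?memv_line.
  have vPi : v \notin Pi by apply: contra vx; apply: (subvP (addvSl _ _)).
  have vxPi : v + x \notin Pi.
    apply: contra vx => vxPi; rewrite -(addrK x v) rpredB //.
    by rewrite (subvP (addvSl _ _)).
  have [c vc] := eig v vPi; have [d vxd] := eig _ vxPi.
  (* Modulo [Pi], the eigenvalues [c], [a], [d] of [v], [x], [v + x] give a linear relation between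
     [v] and [x]; independence yields [c = d = a]. *)
  have key : (c - d) *: v + (a - d) *: x \in Pi.
    have -> : (c - d) *: v + (a - d) *: x =
        (s (v + x) - d *: (v + x)) - ((s v - c *: v) + (s x - a *: x)).
      have tele (p q r : V) : (p - q) - (p - r) = r - q.
        by rewrite opprB addrC addrA subrK.
      rewrite linearD /= scalerDr [- (d *: v + _)]opprD [s v + s x + _]addrACA.
      by rewrite [- (_ - _ + _)]opprD [RHS]addrACA !tele !scalerBl.
    by rewrite rpredB // rpredD.
  have cd : c = d.
    apply/eqP; rewrite -subr_eq0; apply: contraNT vx => cd0.
    rewrite -[v]scale1r -(mulVf cd0) -scalerA rpredZ //.
    rewrite -[X in X \in _](addrK ((a - d) *: x)) rpredB ?rpredZ //.
    by rewrite (subvP (addvSl _ _)).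
  have ad : a = d.
    apply/eqP; rewrite -subr_eq0; apply: contraNT xPi => ad0.
    move: key; rewrite cd subrr scale0r add0r => key.
    by rewrite -[x]scale1r -(mulVf ad0) -scalerA rpredZ.
  by rewrite ad -cd.
move=> v; have [vx|] := boolP (v \in (Pi + <[x]>)%VS); last exact: indep.
(* A vector of [Pi + <[x]>] is the difference of [v + y] and [y], both outside it; such a [y] exists
   since [Pi] has codimension at least 2. *)
have /subvPn[y _ yx] : ~~ ({:V} <= Pi + <[x]>)%VS.
  by apply/negP => /dimvS; rewrite dim_add_line // leqNgt codimPi.
have vy : v + y \notin (Pi + <[x]>)%VS.
  by apply: contra yx => vy; rewrite -(addKr v y) addrC rpredB.
have -> : s v - a *: v = (s (v + y) - a *: (v + y)) - (s y - a *: y).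
  by rewrite linearD scalerDr opprD addrACA addrK.
by rewrite rpredB ?indep.
Qed.

End HyperplanewiseFixed.

(** * Automorphisms of order three of a cubic extension *)

Section CubicAutomorphism.
Variables (F : fieldType) (L : fieldExtType F) (t : 'End(L)).
Hypothesis dimL : \dim {:L} = 3%N.
Hypothesis t1 : t 1 = 1.
Hypothesis tM : forall x y, t (x * y) = t x * t y.
Hypothesis t_neq1 : t <> \1%VF.
Hypothesis t_cube : forall x, t (t (t x)) = x.

(** The fixed field of [t] has degree dividing 3 over [F], and degree 3 would make [t] the
    identity. *)
Lemma fixed_in_base x : t x = x -> exists c, x = c%:A.
Proof.
move=> tx; have xfix : x \in fixedSpace t by apply/fixedSpaceP.
have t_ahom : ahom_in {:L} t by apply/ahom_inP; split=> // y z _ _; apply: tM.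
have : \dim (fixedSpace t) \in divisors 3.
  rewrite -dvdn_divisors // -dimL.
  by rewrite (@field_dimS _ L (fixedSpace_aspace (AHom t_ahom)) {:L}%AS) ?subvf.
rewrite !inE /= => /orP[/eqP d1|/eqP d3].
  have fE : (1 = fixedSpace t)%VS.
    apply: subv_dim_eq; last by rewrite d1 dimv1.
    by rewrite -memvE; apply/fixedSpaceP.
  by move: xfix; rewrite -fE => /vlineP[c ->]; exists c.
case: t_neq1; apply/lfunP => y; rewrite id_lfunE; apply/fixedSpaceP.
by have -> : fixedSpace t = fullv; [apply: subv_dim_eq; rewrite ?subvf ?d3 ?dimL | apply: memvf].
Qed.

(** Its image is the space T of trace-zero elements (additive Hilbert 90). *)
Definition trdiff : 'End(L) := (t - \1)%VF.

Lemma trdiffE x : trdiff x = t x - x.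
Proof. by rewrite !lfunE /= !lfunE /= id_lfunE. Qed.

Lemma dim_trdiff : is_line (limg trdiff).
Proof.
have dk : \dim (lker trdiff) = 1%N.
  have -> : lker trdiff = 1%VS; last exact: dimv1.
  apply/eqP; rewrite eqEsubv; apply/andP; split.
    apply/subvP => x; rewrite memv_ker trdiffE subr_eq0 => /eqP/fixed_in_base[c ->].
    by rewrite rpredZ ?mem1v.
  by rewrite -memvE memv_ker trdiffE t1 subrr.
by have := limg_ker_dim trdiff fullv; rewrite capfv dk dimL => -[].
Qed.

(** If all of T consisted of eigenvectors, two independent ones would share an eigenvalue, and their
    quotient would be fixed by [t], hence in [F]. *)
Lemma trdiff_generator : exists th, [/\ th \in limg trdiff, th != 0,
  t th \notin <[th]>%VS & limg trdiff = (<[th]> + <[t th]>)%VS].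
Proof.
suff [th thT mth] : exists2 th, th \in limg trdiff & t th \notin <[th]>%VS.
  have th0 : th != 0 by apply: contraNneq mth => ->; rewrite linear0 mem0v.
  exists th; split=> //; apply: line_eq_join => //; first exact: dim_trdiff.
  have /memv_imgP[x _ ->] := thT.
  by rewrite trdiffE linearB /= -trdiffE memv_img ?memvf.
have [u [v [u0 vu TE]]] := is_line_basis dim_trdiff.
have [uT vT] : u \in limg trdiff /\ v \in limg trdiff by rewrite TE mem_joinl mem_joinr.
have [su|] := boolP (t u \in <[u]>%VS); last by exists u.
have [sv|] := boolP (t v \in <[v]>%VS); last by exists v.
have [suv|] := boolP (t (u + v) \in <[(u + v)%R]>%VS); last by exists (u + v); rewrite ?rpredD.
have [b [tu tv]] := eigen_line_scalar u0 vu su sv suv.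
have b0 : b != 0.
  apply: contraNneq u0 => b0; rewrite -(t_cube u) tu b0 scale0r !linear0 //.
case/negP: vu; have [|c vE] := @fixed_in_base (v / u).
  have tu0 : t u != 0 by rewrite tu scaler_eq0 negb_or b0.
  apply: (mulIf tu0); rewrite -tM divfK // tv tu -scalerAr divfK //.
by apply/vlineP; exists c; rewrite -mulr_algl -vE divfK.
Qed.

End CubicAutomorphism.

(** * The two scalar multiplications and frames *)

Section ExtensionScaling.
Variables (F : finFieldType) (L : fieldExtType F).
Implicit Types (x y : L) (v w : VF L).

(** Scaling by [L] is typed on the [F]-space so that both scalar multiplications can occur in one
    formula. *)
Definition lsc x v : VF L := x *: (v : VL L).

Lemma lscA x y v : lsc x (lsc y v) = lsc (x * y) v.
Proof. exact: (@scalerA _ (VL L)). Qed.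

Lemma lsc1 v : lsc 1 v = v.
Proof. exact: (@scale1r _ (VL L)). Qed.

Lemma lsc0 v : lsc 0 v = 0.
Proof. exact: (@scale0r _ (VL L)). Qed.

Lemma lscr0 x : lsc x 0 = 0.
Proof. exact: (@scaler0 _ (VL L)). Qed.

Lemma lscDr x v w : lsc x (v + w) = lsc x v + lsc x w.
Proof. exact: (@scalerDr _ (VL L)). Qed.

Lemma lscDl x y v : lsc (x + y) v = lsc x v + lsc y v.
Proof. exact: (@scalerDl _ (VL L)). Qed.

Lemma lscNl x v : lsc (- x) v = - lsc x v.
Proof. exact: (@scaleNr _ (VL L)). Qed.

Lemma lscBl x y v : lsc (x - y) v = lsc x v - lsc y v.
Proof. exact: (@scalerBl _ (VL L)). Qed.

Lemma lsc_eq0 x v : (lsc x v == 0) = (x == 0) || (v == 0).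
Proof. exact: (@scaler_eq0 _ (VL L)). Qed.

Lemma lsc_sumr x (f : 'I_3 -> VF L) : lsc x (\sum_i f i) = \sum_i lsc x (f i).
Proof. exact: (@scaler_sumr _ (VL L)). Qed.

Lemma scale_lsc (c : F) v : c *: v = lsc c%:A v.
Proof. by apply/ffunP=> i; rewrite !ffunE [RHS]mulr_algl. Qed.

Lemma scaler_lsc (c : F) x v : c *: lsc x v = lsc (c *: x) v.
Proof. by rewrite scale_lsc lscA mulr_algl. Qed.

Lemma mem_bose_line v w :
  (w \in bose <[v : VL L]>%VS) <-> exists x, w = lsc x v.
Proof. by rewrite mem_bose; split=> [/vlineP|?]; last apply/vlineP. Qed.

Lemma mem_bose_join u v w :
  (w \in bose (<[u : VL L]> + <[v : VL L]>)%VS) <->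
  exists x y, w = lsc x u + lsc y v.
Proof. by rewrite mem_bose; split=> [/mem_joinP|?]; last apply/mem_joinP. Qed.

Lemma lsc_bose (U : {vspace VL L}) x v : v \in bose U -> lsc x v \in bose U.
Proof. by rewrite !mem_bose => vU; apply: rpredZ. Qed.

Lemma line_lsc v x : x != 0 -> <[lsc x v : VL L]>%VS = <[v : VL L]>%VS.
Proof.
move=> x0; apply/eqP; rewrite eqEsubv -!memvE; apply/andP.
split; apply/vlineP; first by exists x.
by exists x^-1; rewrite -[RHS]/(lsc _ (lsc _ _)) lscA mulVf ?lsc1.
Qed.

Lemma dimVF : \dim {:VF L} = (3 * \dim {:L})%N.
Proof. by rewrite !dimvf /dim /= card_ord. Qed.

Lemma dimVL : \dim {:VL L} = 3%N.
Proof. by rewrite !dimvf /dim /= card_ord /dim /=. Qed.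

Definition comb (E : 'I_3 -> VF L) (y : 'I_3 -> L) := \sum_i lsc (y i) (E i).

Definition frame (S : {vspace VL L} -> Prop) (E : 'I_3 -> VF L) : Prop :=
  [/\ forall v, exists y : 'I_3 -> L, v = comb E y,
      forall y : 'I_3 -> L, comb E y = 0 -> forall i, y i = 0
    & forall P, S P <-> exists2 c : 'I_3 -> F, (exists i, c i != 0) &
        P = <[comb E (fun i => (c i)%:A) : VL L]>%VS].

Lemma frame_of_subplane S : Fq_subplane S -> exists E, frame S E.
Proof.
move=> [e be Se]; exists (fun i => e`_i); split=> // [v|y E0].
  exists (fun i => coord e i (v : VL L)).
  exact: (coord_basis be (memvf (v : VL L))).
have /freeP fe := basis_free be.
by apply: fe; exact: E0.
Qed.

Section Frame.
Variables (S : {vspace VL L} -> Prop) (E : 'I_3 -> VF L).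
Hypothesis frameE : frame S E.

Lemma comb_inj (y z : 'I_3 -> L) : comb E y = comb E z -> forall i, y i = z i.
Proof.
have [_ inj _] := frameE; move=> /eqP; rewrite -subr_eq0 -sumrB => /eqP yz i.
apply/eqP; rewrite -subr_eq0; apply/eqP; apply: (inj (fun i => y i - z i)).
by rewrite -[RHS]yz; apply: eq_bigr => j _; rewrite lscBl.
Qed.

Lemma comb_delta x i : comb E (fun j => if j == i then x else 0) = lsc x (E i).
Proof.
rewrite /comb (bigD1 i) //= eqxx big1 ?addr0 // => j /negPf ->.
exact: lsc0.
Qed.

Lemma comb_scale x (y : 'I_3 -> L) : lsc x (comb E y) = comb E (fun i => x * y i).
Proof. by rewrite lsc_sumr; apply: eq_bigr => i _; rewrite lscA. Qed.

Lemma frame_neq0 i : E i != 0.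
Proof.
apply/eqP => Ei0; have [_ inj _] := frameE.
have := inj (fun j => if j == i then 1 else 0); rewrite comb_delta lsc1 Ei0.
by move=> /(_ erefl i) /eqP; rewrite eqxx oner_eq0.
Qed.

Lemma frame_point i : S <[E i : VL L]>%VS.
Proof.
have [_ _ SE] := frameE; apply/SE; exists (fun j => if j == i then 1 else 0).
  by exists i; rewrite eqxx oner_eq0.
rewrite -[E i in LHS]lsc1 -comb_delta; congr <[_]>%VS; apply: eq_bigr => j _.
by case: eqP => _; rewrite ?scale1r ?scale0r.
Qed.

Lemma frame_unit_point : S <[comb E (fun=> 1%R) : VL L]>%VS.
Proof.
have [_ _ SE] := frameE; apply/SE; exists (fun=> 1).
  by exists ord0; rewrite oner_eq0.
by congr <[_]>%VS; apply: eq_bigr => j _; rewrite scale1r.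
Qed.

(** A common factor in [L] does not change the points spanned; this freedom later absorbs an
    eigenvector of [sigma]. *)
Lemma frame_rescale x : x != 0 -> frame S (fun i => lsc x (E i)).
Proof.
move=> x0; have [gen inj SE] := frameE.
have combE (y : 'I_3 -> L) : comb (fun i => lsc x (E i)) y = comb E (fun i => y i * x).
  by apply: eq_bigr => i _; rewrite lscA.
split=> [v|y y0 i|P].
- have [y ->] := gen v; exists (fun i => y i / x); rewrite combE.
  by apply: eq_bigr => i _; rewrite divfK.
- have := inj (fun i => y i * x); rewrite -combE => /(_ y0 i) /eqP.
  by rewrite mulf_eq0 (negPf x0) orbF => /eqP.
have lineE (c : 'I_3 -> F) :
    <[comb (fun i => lsc x (E i)) (fun i => (c i)%:A) : VL L]>%VS =
    <[comb E (fun i => (c i)%:A) : VL L]>%VS.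
  rewrite combE -[RHS](line_lsc _ x0) comb_scale; congr <[_]>%VS.
  by apply: eq_bigr => i _; rewrite mulrC.
by rewrite SE; split=> -[c c0 ->]; exists c; rewrite // lineE.
Qed.

End Frame.

End ExtensionScaling.

(** * Collineations and the linear maps inducing them *)

Section InducedProjectivity.
Variables (F : finFieldType) (L : fieldExtType F).
Variables (S : {vspace VL L} -> Prop) (phi : {vspace VL L} -> {vspace VL L}).
Hypothesis phi_coll : collineation phi.

Lemma phi0 : phi 0%VS = 0%VS.
Proof.
have [[psi _ phiK] phiS] := phi_coll.
by apply/eqP; rewrite -subv0 -[X in (_ <= X)%VS]phiK phiS sub0v.
Qed.

Lemma phi_inj : injective phi.
Proof. by have [[psi psiK _] _] := phi_coll; apply: can_inj psiK. Qed.

Lemma phi_point P : is_point P -> is_point (phi P).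
Proof.
move=> Pp; have [[psi _ phiK] phiS] := phi_coll.
have [|u uP u0] := @exists_nonzero _ _ (phi P).
  rewrite -phi0 => /phi_inj P0.
  by move: Pp; rewrite /is_point P0 dimv0.
suff -> : phi P = <[u]>%VS by apply: is_point_line.
rewrite -(phiK <[u]>%VS); congr phi; apply/esym/subv_dim_eq.
  by rewrite -phiS phiK -memvE.
rewrite Pp lt0n dimv_eq0; apply: contraNneq u0 => W0.
by move: (memv_line u); rewrite -[<[u]>%VS]phiK W0 phi0 memv0.
Qed.

Lemma phi_id : (forall v : VL L, v != 0 -> phi <[v]>%VS = <[v]>%VS) ->
  forall U, phi U = U.
Proof.
move=> fixp U; have [_ phiS] := phi_coll; apply/eqP; rewrite eqEsubv.
have mem v W : v != 0 -> (v \in phi W) = (v \in W).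
  by move=> v0; rewrite !memvE -{1}(fixp v v0) phiS.
apply/andP; split; apply/subvP => v; have [->|v0] := eqVneq v 0; rewrite ?mem0v //;
  by rewrite mem.
Qed.

Section Linear.
Variable s : 'End(VF L).
Hypothesis s_inj : injective s.
Hypothesis s_phi : forall P : {vspace VL L}, is_point P ->
  (s @: bose P)%VS = bose (phi P).

Lemma phi_line (v : VF L) : v != 0 -> phi <[v : VL L]>%VS = <[s v : VL L]>%VS.
Proof.
move=> v0; have Pp : is_point <[v : VL L]>%VS by apply: is_point_line.
apply: point_eq_line; first exact: phi_point.
  by rewrite -mem_bose -s_phi // memv_img // mem_bose memv_line.
by rewrite -(linear0 s); apply: contra_neq v0 => /s_inj.
Qed.

(** [s] carries the plane over a point onto the plane over its image. The multiplier may still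
    depend on [v]. *)
Lemma s_lsc_ex x (v : VF L) : exists y, s (lsc x v) = lsc y (s v).
Proof.
have [->|v0] := eqVneq v 0; first by exists 0; rewrite lsc0 lscr0 linear0.
apply/mem_bose_line; rewrite -(phi_line v0) -s_phi; last exact: is_point_line.
by rewrite memv_img // mem_bose_line; exists x.
Qed.

End Linear.

End InducedProjectivity.

(** * Semilinear normal form of the induced projectivity *)

Section NormalForm.
Variables (F : finFieldType) (L : fieldExtType F).
Variables (S : {vspace VL L} -> Prop) (phi : {vspace VL L} -> {vspace VL L}).
Variables (sigma : 'End(VF L)) (Pi : {vspace VF L}).
Hypothesis dimL : \dim {:L} = 3%N.
Hypothesis phi_coll : collineation phi.
Hypothesis phi_fixS : forall P, S P -> phi P = P.
Hypothesis sigma_proj : projectivity sigma.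
Hypothesis sigma_phi : forall P : {vspace VL L}, is_point P ->
  (sigma @: bose P)%VS = bose (phi P).
Hypothesis Pi_hwise : hwise_fixed_5space sigma Pi.

Let sigma_inj : injective sigma. Proof. exact/lker0P/eqP. Qed.

Lemma lsc_inj (v : VF L) : v != 0 -> injective (fun x => lsc x v).
Proof.
move=> v0 x y /eqP; rewrite -subr_eq0 -lscBl lsc_eq0 (negPf v0) orbF subr_eq0.
by move/eqP.
Qed.

(** Planes over subplane points are invariant, which gives a multiplier for each basis vector; the
    unit point makes the three multipliers agree. *)
Lemma sigma_frame E : frame S E ->
  exists g : L -> L, forall x i, sigma (lsc x (E i)) = lsc (g x) (E i).
Proof.
move=> frE; have fixed_point (v : VF L) x : v != 0 -> S <[v : VL L]>%VS ->
    exists y, sigma (lsc x v) = lsc y v.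
  move=> v0 Sv; apply/mem_bose_line; rewrite -[<[_]>%VS](phi_fixS Sv) -sigma_phi.
    by apply: memv_img; apply/mem_bose_line; exists x.
  exact: is_point_line.
have scal x : exists y, forall i, sigma (lsc x (E i)) = lsc y (E i).
  have [|z zE] := fixed_point _ x _ (frame_unit_point frE).
    apply/eqP => E0; have [_ inj _] := frE.
    by have /eqP := inj _ E0 ord0; rewrite oner_eq0.
  have /fin_all_exists[y yE] i : exists y, sigma (lsc x (E i)) = lsc y (E i).
    by apply: fixed_point; [exact: (frame_neq0 frE) | exact: (frame_point frE)].
  exists z => i; rewrite yE; congr lsc.
  apply: (comb_inj frE (z := fun=> z)); rewrite /comb.
  rewrite -(eq_bigr _ (fun i _ => yE i)) -linear_sum /= -lsc_sumr.
  have -> : \sum_i E i = comb E (fun=> 1) by apply: eq_bigr => j _; rewrite lsc1.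
  by rewrite zE comb_scale; apply: eq_bigr => j _; rewrite mulr1.
have ex x : exists y, sigma (lsc x (E ord0)) == lsc y (E ord0).
  by have [y yE] := scal x; exists y; rewrite yE.
exists (fun x => xchoose (ex x)) => x i; have [y yE] := scal x.
rewrite yE; congr lsc; apply: (lsc_inj (frame_neq0 frE ord0)).
by rewrite /= -yE; apply/eqP/(xchooseP (ex x)).
Qed.

(** The images of [E ord0 + lsc y (E o1)] and of its multiple by [x] are proportional, say by [z];
    so [g x = z * g 1] and [g (x * y) = z * g y]. *)
Lemma frame_scalar_mul E (g : L -> L) : frame S E ->
    (forall x i, sigma (lsc x (E i)) = lsc (g x) (E i)) ->
  forall x y, g (x * y) * g 1 = g x * g y.
Proof.
move=> frE gE x y; pose o1 : 'I_3 := lift ord0 ord0.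
have coord2 c d : lsc c (E ord0) + lsc d (E o1) =
    comb E (fun i => if i == ord0 then c else if i == o1 then d else 0).
  by rewrite /comb !big_ord_recl big_ord0 /= lsc0 !addr0.
have [z] := s_lsc_ex phi_coll sigma_inj sigma_phi x (E ord0 + lsc y (E o1)).
rewrite lscDr lscA !linearD /= -[E ord0 in X in _ = X]lsc1 !gE lscDr !lscA.
rewrite !coord2 => /(comb_inj frE) zE.
by have /= -> := zE ord0; have /= -> := zE o1; rewrite mulrAC.
Qed.

Lemma exists_normal_form : Fq_subplane S ->
  exists (E : 'I_3 -> VF L) (a : F) (t : 'End(L)),
  [/\ frame S E, a != 0,
      t 1 = 1 /\ (forall x y, t (x * y) = t x * t y),
      forall x i, (a^-1 *: sigma) (lsc x (E i)) = lsc (t x) (E i)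
    & forall v, (a^-1 *: sigma) v - v \in Pi].
Proof.
move=> /frame_of_subplane[E frE]; have [g gE] := sigma_frame frE.
have gM := frame_scalar_mul frE gE.
have [dimPi hPi] := Pi_hwise.
have dV : \dim {:VF L} = 9%N by rewrite dimVF dimL.
have [a aPi] : exists a, forall v, sigma v - a *: v \in Pi.
  by apply: hwise_fixed_scalar; rewrite dimPi ?dV.
(* The image of [sigma - a *: \1] lies in the 6-dimensional [Pi], so its kernel in dimension 9 is
   nonzero. *)
have [v v0 sv] : exists2 v, v != 0 & sigma v = a *: v.
  have [|v] := @exists_nonzero _ _ (lker (sigma - a *: \1)%VF).
    move=> /eqP/lker0_limgf lim.
    suff /dimvS : (limg (sigma - a *: \1)%VF <= Pi)%VS by rewrite lim dV dimPi.
    apply/subvP => _ /memv_imgP[v _ ->].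
    by rewrite !lfunE /= !lfunE /= !lfunE /= id_lfunE aPi.
  rewrite memv_ker !lfunE /= !lfunE /= !lfunE /= id_lfunE subr_eq0 => /eqP sv v0.
  by exists v.
have a0 : a != 0.
  by apply: contraNneq v0 => a0; apply/eqP/sigma_inj; rewrite sv a0 scale0r linear0.
have [gen inj _] := frE; have [y vE] := gen v.
have /existsP[k yk0] : [exists k, y k != 0].
  apply: contraNT v0; rewrite negb_exists => /forallP y0; rewrite vE.
  by rewrite /comb big1 // => i _; rewrite (eqP (negbNE (y0 i))) lsc0.
have gy : g (y k) = a *: y k.
  move: sv; rewrite vE /comb linear_sum /= (eq_bigr _ (fun i _ => gE (y i) i)).
  rewrite scaler_sumr (eq_bigr _ (fun i _ => scaler_lsc a (y i) (E i))).
  by move/(comb_inj frE (y := fun i => g (y i)) (z := fun i => a *: y i)).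
have g10 : g 1 != 0.
  apply/eqP => g10; have := gE 1 ord0; rewrite g10 lsc0 lsc1 -(linear0 sigma).
  by move=> /sigma_inj/eqP; rewrite (negPf (frame_neq0 frE ord0)).
have glin : linear (fun x => g x / g 1).
  move=> c x z; rewrite scalerAl -mulrDl; congr (_ / _).
  apply: (lsc_inj (frame_neq0 frE ord0)) => /=.
  by rewrite lscDl -scaler_lsc -!gE lscDl -scaler_lsc linearP.
pose tl : {linear L -> L} := HB.pack (fun x => g x / g 1)
  (GRing.isLinear.Build _ _ _ _ (fun x => g x / g 1) glin).
have tE x : linfun tl x = g x / g 1 by rewrite lfunE.
(* As [g (y k) = a *: y k], rescaling by this coordinate of the eigenvector makes [a^-1 *: sigma]
   fix the frame; dividing [g] by [g 1] makes it multiplicative. *)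
exists (fun i => lsc (y k) (E i)), a, (linfun tl); split=> //.
- exact: frame_rescale.
- split=> [|x z]; rewrite !tE ?divff //.
  by apply: (mulIf g10); rewrite divfK // -mulrA divfK // mulrAC -gM mulfK.
- move=> x i; rewrite lfunE /= !lscA gE scaler_lsc; congr lsc.
  apply: (mulIf g10); rewrite -scalerAl gM gy -scalerAr scalerA mulVf // scale1r.
  by rewrite mulrAC tE divfK.
move=> w; have := aPi w; rewrite lfunE /= => /(@memvZ _ _ Pi a^-1).
by rewrite scalerBr scalerA mulVf // scale1r.
Qed.

End NormalForm.

(** * The 3-space and its fixed lines *)

Section NormalisedAction.
Variables (F : finFieldType) (L : fieldExtType F).
Variables (S : {vspace VL L} -> Prop) (phi : {vspace VL L} -> {vspace VL L}).
Variables (s : 'End(VF L)) (t : 'End(L)) (E : 'I_3 -> VF L).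
Hypothesis dimL : \dim {:L} = 3%N.
Hypothesis phi_coll : collineation phi.
Hypothesis phi_order : order3 phi.
Hypothesis s_inj : injective s.
Hypothesis s_phi : forall P : {vspace VL L}, is_point P ->
  (s @: bose P)%VS = bose (phi P).
Hypothesis frE : frame S E.
Hypothesis t1 : t 1 = 1.
Hypothesis tM : forall x y, t (x * y) = t x * t y.
Hypothesis sE : forall x i, s (lsc x (E i)) = lsc (t x) (E i).

Lemma s_comb (y : 'I_3 -> L) : s (comb E y) = comb E (fun i => t (y i)).
Proof. by rewrite linear_sum /=; apply: eq_bigr => i _; apply: sE. Qed.

Lemma s_lsc x v : s (lsc x v) = lsc (t x) (s v).
Proof.
have [gen _ _] := frE; have [y ->] := gen v.
rewrite comb_scale !s_comb comb_scale.
by apply: eq_bigr => i _; rewrite tM.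
Qed.

(** Otherwise [s] is the identity, so [phi] fixes every point and hence every subspace, against its
    order. *)
Lemma t_neq1 : t <> \1%VF.
Proof.
move=> tE; have [_ [U]] := phi_order; case; apply: phi_id => // v v0.
rewrite (phi_line phi_coll s_inj s_phi v0).
have [gen _ _] := frE; have [y vE] := gen v.
by rewrite vE s_comb tE; congr <[_]>%VS; apply: eq_bigr => i _; rewrite id_lfunE.
Qed.

Lemma s_eq0 v : (s v == 0) = (v == 0).
Proof. by rewrite -(linear0 s) (inj_eq s_inj) linear0. Qed.

(** The point with coordinates (1, x, 0) is fixed by the cube of [phi]; the coordinate 1 makes the
    proportionality factor 1. *)
Lemma t_cube x : t (t (t x)) = x.
Proof.
pose o1 : 'I_3 := lift ord0 ord0.
pose y (i : 'I_3) := if i == ord0 then 1 else if i == o1 then x else 0.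
have y0 : comb E y != 0.
  apply/eqP => y0; have [_ inj _] := frE.
  by have /eqP := inj _ y0 ord0; rewrite /= oner_eq0.
have [ph3 _] := phi_order; have := ph3 <[comb E y : VL L]>%VS.
rewrite !(phi_line phi_coll s_inj s_phi) ?s_eq0 // => E3.
have : s (s (s (comb E y))) \in bose <[comb E y : VL L]>%VS.
  by rewrite -E3 mem_bose memv_line.
case/mem_bose_line => c; rewrite comb_scale !s_comb => /(comb_inj frE) yE.
by have /= := yE ord0; have /= := yE o1; rewrite !t1 mulr1 => -> <-; rewrite mul1r.
Qed.

Lemma s_cube3 v : s (s (s v)) = v.
Proof.
have [gen _ _] := frE; have [y ->] := gen v; rewrite !s_comb.
by apply: eq_bigr => i _; rewrite t_cube.
Qed.

Lemma t_base c : t c%:A = c%:A.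
Proof. by rewrite linearZ /= t1. Qed.

Lemma s_fixed_comb (c : 'I_3 -> F) :
  s (comb E (fun i => (c i)%:A)) = comb E (fun i => (c i)%:A).
Proof. by rewrite s_comb; apply: eq_bigr => i _; rewrite t_base. Qed.

Let base := fixed_in_base dimL t1 tM t_neq1.

(** If [s v] is an [L]-multiple of [v], the ratios of coordinates of [v] are fixed by [t], hence lie
    in [F]. *)
Lemma fixed_point_S (v : VF L) :
  v != 0 -> phi <[v : VL L]>%VS = <[v : VL L]>%VS -> S <[v : VL L]>%VS.
Proof.
move=> v0; rewrite (phi_line phi_coll s_inj s_phi) // => svE.
have : s v \in bose <[v : VL L]>%VS by rewrite -svE mem_bose memv_line.
case/mem_bose_line => c; have [gen _ SE] := frE; have [y vE] := gen v.
rewrite vE comb_scale s_comb => /(comb_inj frE) ty.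
have /existsP[k yk0] : [exists k, y k != 0].
  apply: contraNT v0; rewrite negb_exists => /forallP y0; rewrite vE.
  by rewrite /comb big1 // => i _; rewrite (eqP (negbNE (y0 i))) lsc0.
have /fin_all_exists[d dE] i : exists d, y i / y k = d%:A.
  apply: base; have c0 : c * y k != 0.
    rewrite -ty; apply: contra_neq yk0 => tyk.
    by rewrite -(t_cube (y k)) tyk !linear0.
  by apply: (mulIf c0); rewrite -{1}ty -tM divfK // ty mulrCA divfK.
apply/SE; exists d.
  by exists k; apply/eqP => dk; have /eqP := dE k; rewrite dk divff // scale0r oner_eq0.
rewrite -[RHS](line_lsc _ yk0) comb_scale; congr <[_]>%VS.
by apply: eq_bigr => i _; rewrite -dE mulrC divfK.
Qed.

Definition sdiff : 'End(VF L) := (s - \1)%VF.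

Lemma sdiffE v : sdiff v = s v - v.
Proof. by rewrite !lfunE /= !lfunE /= id_lfunE. Qed.

(** A fixed vector has coordinates in [F], so the kernel has dimension at most 3. This bound forces
    [Pi] to equal the image. *)
Lemma dim_limg_sdiff : (6 <= \dim (limg sdiff))%N.
Proof.
have dk : (\dim (lker sdiff) <= 3)%N.
  suff /dimvS : (lker sdiff <= <<codom E>>)%VS.
    by move/leq_trans; apply; rewrite (leq_trans (dim_span _)) // size_codom card_ord.
  apply/subvP => v; rewrite memv_ker sdiffE subr_eq0 => /eqP.
  have [gen _ _] := frE; have [y ->] := gen v; rewrite s_comb => /(comb_inj frE) ty.
  apply: rpred_sum => i _; have [c ->] := base (ty i).
  by rewrite -scale_lsc rpredZ // memv_span // codom_f.
have := limg_ker_dim sdiff fullv; rewrite capfv dimVF dimL => dE.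
by rewrite -(leq_add2l 3) -[(3 + 6)%N]/(3 * 3)%N -dE leq_add2r.
Qed.

Lemma limg_sdiff_quad v : v \in limg sdiff -> s (s v) = - (s v + v).
Proof.
move=> /memv_imgP[w _ ->]; rewrite sdiffE !linearB /= s_cube3.
by rewrite addrA subrK opprB.
Qed.

Lemma limg_sdiff_stable v : v \in limg sdiff -> s v \in limg sdiff.
Proof.
by move=> /memv_imgP[w _ ->]; rewrite sdiffE linearB /= -sdiffE memv_img ?memvf.
Qed.

Lemma type_I_line_basis l : type_I_line S l ->
  exists u1 u2 : VF L, [/\ s u1 = u1, s u2 = u2, u1 != 0,
    (u2 : VL L) \notin <[u1 : VL L]>%VS & l = (<[u1 : VL L]> + <[u2 : VL L]>)%VS].
Proof.
move=> [dl [sq [sq_uniq sq_size sqE]]]; have [_ _ SE] := frE.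
have q0 : (0 < #|F|)%N by apply/card_gt0P; exists 0.
pose P1 := nth 0%VS sq 0; pose P2 := nth 0%VS sq 1.
have P1s : P1 \in sq by rewrite mem_nth // sq_size addn1.
have P2s : P2 \in sq by rewrite mem_nth // sq_size addn1.
have P12 : P1 != P2 by rewrite nth_uniq // sq_size addn1.
have pt P : S P -> exists2 u : VF L, s u = u & u != 0 /\ P = <[u : VL L]>%VS.
  case/SE => c [k ck] PE; exists (comb E (fun i => (c i)%:A)).
    exact: s_fixed_comb.
  split=> //; apply/eqP => c0; have [_ inj _] := frE.
  by have /eqP := inj _ c0 k; rewrite scaler_eq0 oner_eq0 orbF (negPf ck).
have [/pt[u1 su1 [u10 P1E]] P1l] := (sqE _).1 P1s.
have [/pt[u2 su2 [u20 P2E]] P2l] := (sqE _).1 P2s.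
have u21 : (u2 : VL L) \notin <[u1 : VL L]>%VS.
  apply: contra P12 => u21; rewrite P1E P2E; apply/eqP.
  by apply: point_eq_line => //; apply: is_point_line.
exists u1, u2; split=> //; apply: line_eq_join => //.
  by rewrite memvE -P1E.
by rewrite memvE -P2E.
Qed.

Variables (Pi : {vspace VF L}) (l : {vspace VL L}).
Hypothesis dimPi : \dim Pi = 6%N.
Hypothesis sPi : forall v, s v - v \in Pi.
Hypothesis l_I : type_I_line S l.

Lemma hwise_eq_limg : Pi = limg sdiff.
Proof.
apply/esym/subv_dim_eq; last by rewrite dimPi dim_limg_sdiff.
by apply/subvP => _ /memv_imgP[v _ ->]; rewrite sdiffE.
Qed.

Lemma bose_line_stable v : v \in bose l -> s v \in bose l.
Proof.
have [u1 [u2 [su1 su2 _ _ ->]]] := type_I_line_basis l_I.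
case/mem_bose_join => x [y ->]; rewrite linearD /= !s_lsc su1 su2.
by apply/mem_bose_join; exists (t x), (t y).
Qed.

Lemma section_stable v : v \in (Pi :&: bose l)%VS -> s v \in (Pi :&: bose l)%VS.
Proof.
rewrite hwise_eq_limg !memv_cap => /andP[vT vl].
by rewrite limg_sdiff_stable ?bose_line_stable.
Qed.

Lemma section_quad v : v \in (Pi :&: bose l)%VS -> s (s v) = - (s v + v).
Proof. by rewrite hwise_eq_limg => /memv_capP[vT _]; apply: limg_sdiff_quad. Qed.

(* A vector fixed by [s] and lying off [l] splits [s - 1] along [l]. *)
Lemma section_sdiff v : v \in (Pi :&: bose l)%VS ->
  exists2 w, w \in bose l & v = s w - w.
Proof.
have [dl _] := l_I; have [gen _ _] := frE.
rewrite hwise_eq_limg => /memv_capP[/memv_imgP[w _ ->] vl].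
have /existsP[k kl] : [exists k, (E k : VL L) \notin l].
  rewrite -negb_forall; apply/negP => /forallP El.
  suff /dimvS : (fullv <= l)%VS by rewrite dimVL dl.
  apply/subvP => x _; rewrite -mem_bose; have [y ->] := gen x.
  by apply: rpred_sum => i _; rewrite lsc_bose ?mem_bose.
have full : (l + <[E k : VL L]>)%VS = fullv.
  by apply: subv_dim_eq; rewrite ?subvf // dim_add_line // dl dimVL.
have : (w : VL L) \in (l + <[E k : VL L]>)%VS by rewrite full memvf.
case/memv_addP => w' w'l [_ /vlineP[z ->] wE].
have {}wE : w = w' + lsc z (E k) by [].
have w'b : (w' : VF L) \in bose l by rewrite mem_bose.
have sEk : s (E k) = E k by rewrite -[in LHS](lsc1 (E k)) sE t1 lsc1.
have sdE : sdiff w = (s w' - w') + lsc (t z - z) (E k).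
  by rewrite sdiffE wE linearD /= s_lsc sEk lscBl opprD addrACA.
(* The multiple of [E k] lies in [bose l], while [E k] does not, so it is zero and [w'] serves as
   preimage. *)
have : lsc (t z - z) (E k) \in bose l.
  rewrite -[X in X \in _](addKr (s w' - w')) -sdE addrC rpredB //.
  by rewrite rpredB ?bose_line_stable.
have [tz0 _|tz0 /(lsc_bose (t z - z)^-1)] := eqVneq (t z - z) 0.
  by exists w' => //; rewrite sdE tz0 lsc0 addr0.
by rewrite lscA mulVf // lsc1 mem_bose (negPf kl).
Qed.

Lemma section_splitting : exists a : {vspace VF L},
  [/\ (a <= Pi :&: bose l)%VS, is_line a, Defs.skew a (s @: a)%VS
    & (a + s @: a = Pi :&: bose l)%VS].
Proof.
have [u1 [u2 [su1 su2 u10 u21 lE]]] := type_I_line_basis l_I.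
have [th [thT th0 tth TE]] := trdiff_generator dimL t1 tM t_neq1 t_cube.
have uniq2 x y : lsc x u1 + lsc y u2 = 0 -> x = 0 /\ y = 0.
  move=> /eqP; rewrite addrC addr_eq0 => /eqP xy.
  have y0 : y = 0.
    apply/eqP; apply: contraNT u21 => y0; apply/vlineP; exists (- (y^-1 * x)).
    rewrite -[RHS]/(lsc _ _) -[u2]lsc1 -(mulVf y0) -lscA xy.
    by rewrite -lscNl lscA mulrN.
  move: xy; rewrite y0 lsc0 => /esym/eqP; rewrite oppr_eq0 lsc_eq0.
  by rewrite (negPf u10) orbF => /eqP.
pose w1 := lsc th u1; pose w2 := lsc th u2; pose a := (<[w1]> + <[w2]>)%VS.
have memS u x : x \in limg (trdiff t) -> s u = u -> u \in bose l ->
    lsc x u \in (Pi :&: bose l)%VS.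
  move=> /memv_imgP[y _ ->] su ul; rewrite memv_cap lsc_bose // andbT.
  by rewrite trdiffE lscBl -{1}su -s_lsc.
have u1l : u1 \in bose l by rewrite mem_bose lE mem_joinl.
have u2l : u2 \in bose l by rewrite mem_bose lE mem_joinr.
have aS : (a <= Pi :&: bose l)%VS by rewrite join_subv ?memS.
have sw u : s u = u -> s (lsc th u) = lsc (t th) u by move=> su; rewrite s_lsc su.
(* Independence of [th] and [t th] over [F] separates [a] from its image. *)
have tdep (c d : F) : c *: th = d *: t th -> c *: th = 0.
  move=> cd; have [d0|d0] := eqVneq d 0; first by rewrite cd d0 scale0r.
  case/negP: tth; apply/vlineP; exists (d^-1 * c).
  by rewrite -scalerA cd scalerA mulVf ?scale1r.
exists a; split=> //.
- apply: dim_join; first by rewrite lsc_eq0 negb_or th0.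
  apply/negP => /vlineP[c]; rewrite scaler_lsc => /eqP; rewrite eq_sym -subr_eq0.
  by rewrite -lscNl => /eqP/uniq2[_ /eqP]; rewrite oppr_eq0 (negPf th0).
- apply/skew_vecP => v /mem_joinP[c [d ->]] /memv_imgP[_ /mem_joinP[c' [d' ->]]].
  rewrite linearD !linearZ /= !sw // !scaler_lsc => /eqP.
  rewrite -subr_eq0 opprD addrACA -!lscBl => /eqP/uniq2[/subr0_eq/tdep -> /subr0_eq/tdep ->].
  by rewrite !lsc0 addr0.
apply/eqP; rewrite eqEsubv subv_add aS /=; apply/andP; split.
  by apply/subvP => _ /memv_imgP[v va ->]; apply/section_stable/(subvP aS).
apply/subvP => v /section_sdiff[w wl ->].
have [x [y ->]] : exists x y, w = lsc x u1 + lsc y u2 by apply/mem_bose_join; rewrite -lE.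
(* A trace-zero element is [c *: th + d *: t th], and [lsc (t th) u] is the image of [lsc th u] when
   [s u = u]. *)
have inA u z : s u = u -> lsc th u \in a -> lsc (t z - z) u \in (a + s @: a)%VS.
  move=> su ua; have : t z - z \in limg (trdiff t) by rewrite -trdiffE memv_img ?memvf.
  rewrite TE => /mem_joinP[c [d ->]]; rewrite lscDl -!scaler_lsc -sw //.
  by rewrite memv_add // rpredZ // memv_img.
rewrite linearD /= !s_lsc su1 su2 opprD addrACA -!lscBl rpredD //; apply: inA => //.
  exact: mem_joinl.
exact: mem_joinr.
Qed.

Lemma section_dim : \dim (Pi :&: bose l) = 4%N.
Proof.
have [a [aS da sk <-]] := section_splitting.
by rewrite dimv_disjoint_sum // (dim_s_img section_quad aS) da.
Qed.

(** The witness points of fixed-I-lines and fixed-II-lines are moved by [s]; conversely a moved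
    point of the 3-space has one of the two types, its images being collinear on [m]. *)
Lemma fixed_lines_inv (sg : 'End(VF L)) (m : {vspace VF L}) :
    (forall U, sg @: U = s @: U)%VS ->
  fixed_lines_in S phi sg (Pi :&: bose l) m <-> inv_line s (Pi :&: bose l) m.
Proof.
move=> sgE; split=> [[mf mS]|[dm mS sm [v vm mv]]].
  have moved (A : {vspace VF L}) v : A = <[v]>%VS -> A <> (s @: A)%VS -> s v \notin <[v]>%VS.
    move=> -> An; apply/negP => svv; apply: An; rewrite limg_line.
    have [->|v0] := eqVneq v 0; first by rewrite linear0.
    by apply: point_eq_line => //; [apply: is_point_line | rewrite s_eq0].
  case: mf => -[dm sm [A]].
    move=> [[dA _] [[An _ _] _]] Am; rewrite !sgE in sm An; split=> //.
    have [v _ AE] := pointP dA; exists v; first by rewrite memvE -AE.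
    exact: moved AE An.
  move=> [[dA [P [Pp [[Pn _ _] _]] AP]] _] Am; rewrite !sgE in sm; split=> //.
  have [v v0 AE] := pointP dA; exists v; first by rewrite memvE -AE.
  have vP : v \in bose P by rewrite (subvP AP) // AE memv_line.
  (* Were [v] an eigenvector, it would lie in both [P] and [phi P], making these points equal. *)
  apply/negP => svv; apply: Pn.
  have svP : s v \in bose (phi P) by rewrite -s_phi // memv_img.
  have vP' : v \in bose (phi P).
    have /vlineP[c svc] := svv; have c0 : c != 0.
      by apply: contraNneq v0 => c0; rewrite -s_eq0 svc c0 scale0r.
    by rewrite -[v]scale1r -(mulVf c0) -scalerA -svc rpredZ.
  rewrite !mem_bose in vP vP'.
  rewrite [RHS](point_eq_line (phi_point phi_coll Pp) vP' v0).
  exact: point_eq_line.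
split=> //; have v0 : v != 0 by apply: contraNneq mv => ->; rewrite linear0 mem0v.
have vS := subvP mS _ vm; have /memv_capP[_ vl] := vS.
have dA : is_point <[v]>%VS by apply: is_point_line.
have Am : (<[v]> <= m)%VS by rewrite -memvE.
have sAm : (s @: <[v]> <= m)%VS by rewrite -sm limgS.
have ssAm : (s @: (s @: <[v]>) <= m)%VS by rewrite -sm limgS.
have colA : collinear <[v]>%VS (sg @: <[v]>)%VS (sg @: (sg @: <[v]>))%VS.
  by exists m; rewrite !sgE.
have Pp : is_point <[v : VL L]>%VS by apply: is_point_line.
(* A point fixed by [phi] belongs to [S], giving Type I; a moved one has its three images on [l],
   giving Type II. *)
have [phiP|phiP] := eqVneq (phi <[v : VL L]>%VS) <[v : VL L]>%VS.
  left; split; rewrite ?sgE //; exists <[v]>%VS => //; split.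
    split=> //; exists <[v : VL L]>%VS; first by split=> //; apply: fixed_point_S.
    by rewrite -memvE mem_bose memv_line.
  split=> //; rewrite !sgE !limg_line; have n1 : <[v]>%VS <> <[s v]>%VS.
    by move=> vE; move: mv; rewrite vE memv_line.
  have sK (U : {vspace VF L}) : (s @: (s @: (s @: U)) = U)%VS.
    rewrite -!limg_comp -[RHS]lim1g; apply: eq_in_limg => x _.
    by rewrite !comp_lfunE id_lfunE s_cube3.
  split=> // vE; apply: n1.
    by rewrite -[RHS]limg_line [X in (s @: X)%VS]vE -!limg_line sK.
  by rewrite -!limg_line in vE *; rewrite -[LHS]sK -!vE.
right; split; rewrite ?sgE //; exists <[v]>%VS => //; split=> //.
split=> //; exists <[v : VL L]>%VS; last by rewrite -memvE mem_bose memv_line.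
have [ph3 _] := phi_order; have [dl _] := l_I.
split=> //; split.
  split=> [/esym/eqP|PE|/(phi_inj phi_coll)/esym/eqP]; rewrite ?(negPf phiP) //.
  by case/eqP: phiP; rewrite PE ph3.
exists l; split=> //; first by rewrite -memvE -mem_bose.
  by rewrite (phi_line phi_coll s_inj s_phi v0) -memvE -mem_bose bose_line_stable.
rewrite !(phi_line phi_coll s_inj s_phi) ?s_eq0 // -memvE -mem_bose.
by rewrite !bose_line_stable.
Qed.

End NormalisedAction.

Lemma limg_scalef (K : fieldType) (V : vectType K) (c : K) (f : 'End(V)) (U : {vspace V}) :
  c != 0 -> ((c *: f) @: U = f @: U)%VS.
Proof.
move=> c0; apply/eqP; rewrite eqEsubv; apply/andP; split; apply/subvP => w.
  by case/memv_imgP=> v vU ->; rewrite lfunE /= rpredZ // memv_img.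
case/memv_imgP=> v vU ->; rewrite -[f v]scale1r -(mulVf c0) -scalerA rpredZ //.
by apply/memv_imgP; exists v; rewrite ?lfunE.
Qed.

(** * Pointwise fixed lines as eigenlines *)

Section PointwiseFixedLines.
Variables (F : finFieldType) (L : fieldExtType F) (sigma s : 'End(VF L)).
Variable (Sg a : {vspace VF L}).
Hypothesis sigmaE : forall U, (sigma @: U = s @: U)%VS.
Hypothesis s_inj : injective s.
Hypothesis s_stable : forall v, v \in Sg -> s v \in Sg.
Hypothesis s_quad : forall v, v \in Sg -> s (s v) = - (s v + v).
Hypothesis dimSg : \dim Sg = 4%N.
Hypothesis aS : (a <= Sg)%VS.
Hypothesis dima : is_line a.
Hypothesis skew_a : Defs.skew a (s @: a)%VS.

Lemma eigenline_ptwise_fixed b : b ^+ 2 + b + 1 = 0 ->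
  ptwise_fixed_line sigma (eigenline s a b).
Proof.
move=> rb; split; first exact: (dim_eigenline s_quad aS dima skew_a).
move=> _ /pointP[v v0 ->]; rewrite -memvE sigmaE limg_line.
move=> /(mem_eigenline s_stable s_quad dimSg aS dima skew_a _ rb)[_ svb].
apply: esym; apply: point_eq_line; first exact: is_point_line.
  by rewrite svb rpredZ // memv_line.
by rewrite -(linear0 s) (inj_eq s_inj).
Qed.

Lemma ptwise_fixed_is_eigenline m : ptwise_fixed_line sigma m -> (m <= Sg)%VS ->
  exists2 b, b ^+ 2 + b + 1 = 0 & m = eigenline s a b.
Proof.
move=> [dm fixm] mS.
apply: (ptwise_fixed_eigenline s_stable s_quad dimSg aS dima skew_a) => // v vm.
have [->|v0] := eqVneq v 0; first by rewrite linear0 mem0v.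
have := fixm <[v]>%VS (is_point_line v0); rewrite -memvE sigmaE limg_line.
by move=> /(_ vm) <-; apply: memv_line.
Qed.

End PointwiseFixedLines.

(** * The three congruences according to q modulo 3 *)

Theorem theorem15 (F : finFieldType) (L : fieldExtType F)
  (q_gt2 : (2 < #|F|)%N) (dimL : \dim {:L} = 3%N)
  (S : {vspace VL L} -> Prop) (phi : {vspace VL L} -> {vspace VL L})
  (S_subplane : Fq_subplane S)
  (phi_coll : collineation phi) (phi_order : order3 phi)
  (phi_fixS : forall P : {vspace VL L}, S P -> phi P = P)
  (sigma : 'End(VF L))
  (sigma_proj : projectivity sigma)
  (sigma_order : order3 (fun U : {vspace VF L} => (sigma @: U)%VS))
  (sigma_phi : forall P : {vspace VL L}, is_point P ->
     (sigma @: bose P)%VS = bose (phi P))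
  (Pi HI : {vspace VF L})
  (Pi_hwise : hwise_fixed_5space sigma Pi) (HI_I : HI_5space S HI) :
  let Sigma3 := (Pi :&: HI)%VS in
  let FF := fixed_lines_in S phi sigma Sigma3 in
  \dim Sigma3 = 4%N /\
  [/\ #|F| = 2 %[mod 3] -> elliptic_congruence Sigma3 FF,
      #|F| = 0 %[mod 3] ->
        exists l : {vspace VF L},
          [/\ ptwise_fixed_line sigma l, (l <= Sigma3)%VS,
              forall m : {vspace VF L}, ptwise_fixed_line sigma m ->
                (m <= Sigma3)%VS -> m = l
            & parabolic_congruence Sigma3 (fun m => FF m \/ m = l) l]
    & #|F| = 1 %[mod 3] ->
        exists l1 l2 : {vspace VF L},
          [/\ l1 <> l2,
              ptwise_fixed_line sigma l1 /\ (l1 <= Sigma3)%VS,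
              ptwise_fixed_line sigma l2 /\ (l2 <= Sigma3)%VS,
              forall m : {vspace VF L}, ptwise_fixed_line sigma m ->
                (m <= Sigma3)%VS -> m = l1 \/ m = l2
            & hyperbolic_congruence Sigma3 FF l1 l2]].
Proof.
move=> Sigma3 FF.
have [E [a0 [t [frE a0n [t1 tM] sE sPi]]]] :=
  exists_normal_form dimL phi_coll phi_fixS sigma_proj sigma_phi Pi_hwise S_subplane.
(* [s] and [sigma] act alike on subspaces, so fixed lines can be computed with [s]. *)
set s := (a0^-1 *: sigma)%VF in sE sPi.
have sigmaE U : (sigma @: U = s @: U)%VS by rewrite limg_scalef ?invr_eq0.
have s_inj : injective s.
  move=> x y; rewrite !lfunE /= => /(scalerI (invr_neq0 a0n)).
  exact/lker0P/eqP.
have s_phi P : is_point P -> (s @: bose P)%VS = bose (phi P).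
  by move=> Pp; rewrite -sigmaE sigma_phi.
have [dimPi _] := Pi_hwise; case: HI_I @Sigma3 @FF => l l_I -> Sigma3 FF.
have stable := section_stable dimL phi_coll phi_order s_inj s_phi frE t1 tM sE dimPi sPi l_I.
have quad v : v \in Sigma3 -> s (s v) = - (s v + v).
  exact: (section_quad dimL phi_coll phi_order s_inj s_phi frE t1 tM sE dimPi sPi).
have dimS : \dim Sigma3 = 4%N.
  exact: (section_dim dimL phi_coll phi_order s_inj s_phi frE t1 tM sE dimPi sPi l_I).
have [a [aS da ska _]] :=
  section_splitting dimL phi_coll phi_order s_inj s_phi frE t1 tM sE dimPi sPi l_I.
have FFE m : FF m <-> inv_line s Sigma3 m.
  exact: (fixed_lines_inv dimL phi_coll phi_order s_inj s_phi frE t1 tM sE _ l_I _ sigmaE).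
have fixE b : b ^+ 2 + b + 1 = 0 -> ptwise_fixed_line sigma (eigenline s a b).
  exact: (eigenline_ptwise_fixed sigmaE s_inj stable quad dimS aS da ska).
have eigS b : b ^+ 2 + b + 1 = 0 -> (eigenline s a b <= Sigma3)%VS.
  exact: (eigenline_sub stable quad dimS aS da ska).
have fixedE m : ptwise_fixed_line sigma m -> (m <= Sigma3)%VS ->
    exists2 b, b ^+ 2 + b + 1 = 0 & m = eigenline s a b.
  exact: (ptwise_fixed_is_eigenline sigmaE stable quad dimS aS da ska).
split=> //; split=> [q2|q0|q1].
- exact: (elliptic_inv_lines stable quad dimS FFE (no_root_of_card2mod3 q2)).
- have char3 : 1 + 1 + 1 = 0 :> F by apply/card_mod3_char.
  have r1 : (1 : F) ^+ 2 + 1 + 1 = 0 by rewrite expr1n.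
  exists (eigenline s a 1); split=> //; [exact: fixE | exact: eigS | |].
    move=> m mf mS; have [b rb ->] := fixedE m mf mS; congr eigenline.
    have /eqP : (b - 1) ^+ 2 = 0.
      have -> : (b - 1) ^+ 2 = (b ^+ 2 + b + 1) - (1 + 1 + 1) * b by ring.
      by rewrite rb char3 mul0r subr0.
    by rewrite sqrf_eq0 subr_eq0 => /eqP.
  exact: (parabolic_inv_lines stable quad dimS aS da ska char3 FFE).
have [b [b' [rb rb' bb']]] := two_roots_of_card1mod3 q1.
have hyp := hyperbolic_inv_lines stable quad dimS aS da ska FFE rb rb' bb'.
exists (eigenline s a b), (eigenline s a b'); split=> //.
- have [[dl _] _ + _] := hyp; move=> sk bE.
  by move: sk dl; rewrite /Defs.skew /is_line -bE capvv => ->; rewrite dimv0.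
- by split; [apply: fixE | apply: eigS].
- by split; [apply: fixE | apply: eigS].
move=> m mf mS; have [c rc ->] := fixedE m mf mS.
(* The factorisation of [c ^+ 2 + c + 1] shows that only the two eigenlines occur. *)
have : (c - b) * (c - b') == 0.
  have -> : (c - b) * (c - b') =
    (c ^+ 2 + c + 1) - (b ^+ 2 + b + 1) + (b - c) * (b + b' + 1) by ring.
  by rewrite rc rb (distinct_roots_sum rb rb' bb') mulr0 subrr addr0.
by rewrite mulf_eq0 !subr_eq0 => /orP[] /eqP ->; [left | right].
Qed.
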